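(* Let $M \geq 0$ and $\mu > 0$ be fixed real numbers. Let $r\in\mathbb{R}$ with $|r|\leq M$, let $y>0$ be real, put $t = y \cosh \mu$ and $\nu=r+it$. Then, as $y\to\infty$, $$\begin{aligned} K_\nu(y) = \sqrt{\frac{2\pi}{y \sinh \mu}}\,e^{-y \frac \pi 2 \cosh \mu +i r \frac \pi 2}& \Big[\cosh(r \mu) \sin\left(\tfrac \pi 4 - y \left(\sinh \mu - \mu \cosh \mu \right)\right) \\ &\quad -i \sinh(r \mu)\cos\left(\tfrac \pi 4 - y \left(\sinh \mu - \mu \cosh \mu \right)\right)\Big] \\ &+O\left(y^{-3/2}e^{-y\left( \frac \pi 2 \cosh \mu + i \left(\sinh \mu - \mu \cosh \mu \right)\right)} \right) \\&+O\left(y^{-3/2}e^{-y\left( \frac \pi 2 \cosh \mu - i \left(\sinh \mu - \mu \cosh \mu \right)\right)} \right), \end{aligned}$$ where the implied constants depend on $\mu$ and $M$.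
   Context: $K_\nu$ denotes the $K$-Bessel function (modified Bessel function of the second kind), for $y>0$ and $\nu\in\mathbb{C}$ given by $K_\nu(y)=\frac12\int_{-\infty}^{\infty} e^{-y\cosh R+\nu R}\,dR$. *)

(* Defs.v *)
From Stdlib Require Import Reals.
From Coquelicot Require Import Coquelicot.
Open Scope C_scope.

Definition Cexp (z : C) : C :=
  RtoC (exp (Re z)) * (RtoC (cos (Im z)) + Ci * RtoC (sin (Im z))).

(* K_nu(y) = (1/2) int_{-oo}^{+oo} exp (- y cosh u + nu u) du, as an improper
   integral with values in C; meaningful for y > 0, where it converges. *)
Definition besselK (nu : C) (y : R) : C :=
  RtoC (1 / 2) *
  RInt_gen (V := C_R_CompleteNormedModule)
    (fun u : R => Cexp (RtoC (- y * cosh u) + nu * RtoC u))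
    (Rbar_locally m_infty) (Rbar_locally p_infty).

(* f r y = O (g y) as y -> +oo, uniformly in the r satisfying P: neither the
   implied constant nor the threshold on y depends on r. *)
Definition unif_bigO (P : R -> Prop) (f : R -> R -> C) (g : R -> C) : Prop :=
  exists K : R,
    Rbar_locally p_infty
      (fun y : R => forall r : R, P r -> (Cmod (f r y) <= K * Cmod (g y))%R).

(* Main.v *)
Require Import Defs.
From Stdlib Require Import Reals Lra.
From Coquelicot Require Import Coquelicot.

(** The proof is a steepest-descent argument with an explicit piecewise linear
    contour.

    With [t = y cosh mu] the integrand of [2 K_nu(y)] is the entire function
    [exp (- y cosh z + (r + i t) z)], called [kernel] below.  Its exponent is
    stationary, up to the bounded term [r z], at [z = ± mu + i pi/2], where its
    modulus is [exp (- y (pi/2) cosh mu ± r mu)]: these two saddle points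
    produce the two exponentials that combine into the sine and the cosine of
    the theorem.

    Since the kernel is entire it has a primitive ([kernel_primitive],
    [is_RInt_kernel]), so contours can be changed by comparing values of the
    primitive at endpoints, and [2 K_nu(y)] is the difference of the limits of
    the primitive at the two ends of the real line.  The reflection
    [z |-> - conj z] exchanges [r] with [- r] ([kernel_primitive_reflect]).
    It reduces the left end to the right one, and the contribution of the
    point [i (pi/2 + d)] of the imaginary axis, at which the contour is cut,
    cancels exactly against that of the other half.

    From this point the contour runs horizontally to [mu - d + i (pi/2 + d)],
    descends with slope [-1] through the saddle to [mu + d + i (pi/2 - d)], and
    goes to infinity horizontally.  Slope [-1] is the direction of steepest
    descent: there the quadratic part of the exponent is the real number
    [- y sinh mu s^2].  On both horizontal parts the kernel is exponentially
    smaller than at the saddle, because [cosh x sin d - d cosh mu] is positive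
    for [x >= mu + d] and negative for [0 <= x <= mu - d] ([contour_gaps]), provided
    that [d] is a small multiple of [tanh mu].

    On the sloped segment, pairing [s] with [- s] removes the odd part of the
    rest of the exponent to first order, so the relative correction to the
    Gaussian is [O(y s^4 + (y s^3 + s)^2)], that is [O(1/y)] at the scale
    [s ~ y^(-1/2)] ([saddle_pointwise]).  Integration against the Gaussian gives
    the main term with an error [O(y^(-3/2))] ([saddle_segment],
    [half_line_asymptotics]).  As both error terms of the theorem have modulus
    [y^(-3/2) exp (- y (pi/2) cosh mu)], one of them can be taken to be 0. *)

Open Scope R_scope.

(** * Closed forms in the plane *)

Lemma is_derive_eq (f g : R -> R) (x l l' : R) :
  is_derive f x l -> (forall u, f u = g u) -> l = l' -> is_derive g x l'.
Proof. intros H E <-. exact (is_derive_ext f g x l E H). Qed.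

Lemma continuity_2d_pt_comp2 (f g h : R -> R -> R) (x y : R) :
  continuity_2d_pt f (g x y) (h x y) ->
  continuity_2d_pt g x y -> continuity_2d_pt h x y ->
  continuity_2d_pt (fun u v => f (g u v) (h u v)) x y.
Proof.
  intros Hf Hg Hh eps.
  destruct (Hf eps) as [d Hd], (Hg d) as [d1 H1], (Hh d) as [d2 H2].
  exists (mkposreal _ (Rmin_stable_in_posreal d1 d2)); simpl; intros u v Hu Hv.
  apply Hd; [apply H1 | apply H2];
    (eapply Rlt_le_trans; [eassumption|]); auto using Rmin_l, Rmin_r.
Qed.

Lemma continuity_2d_pt_continuous_snd (f : R -> R -> R) (x y : R) :
  continuity_2d_pt f x y -> continuous (fun v => f x v) y.
Proof.
  intros Hf. apply filterlim_locally. intros eps.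
  destruct (Hf eps) as [d Hd]. exists d. intros v Hv.
  apply Hd; [|exact Hv].
  rewrite Rminus_diag, Rabs_R0. apply cond_pos.
Qed.

Ltac continuity_2d :=
  repeat first
    [ apply continuity_2d_pt_const | apply continuity_2d_pt_id1
    | apply continuity_2d_pt_id2
    | apply continuity_2d_pt_minus | apply continuity_2d_pt_plus
    | apply continuity_2d_pt_opp
    | apply continuity_2d_pt_mult
    | apply (continuity_1d_2d_pt_comp exp);
      [apply derivable_continuous_pt, derivable_pt_exp|]
    | apply (continuity_1d_2d_pt_comp cosh);
      [apply derivable_continuous_pt, derivable_pt_cosh|]
    | apply (continuity_1d_2d_pt_comp sinh);
      [apply derivable_continuous_pt, derivable_pt_sinh|]
    | apply (continuity_1d_2d_pt_comp cos); [apply continuity_cos|]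
    | apply (continuity_1d_2d_pt_comp sin); [apply continuity_sin|] ].

(** Candidate for a primitive of the form [P dx + Q dh]: its integral along the
    segment from the origin to [(x, h)]. *)
Definition potential (P Q : R -> R -> R) (x h : R) : R :=
  RInt (fun tau => x * P (tau * x) (tau * h) + h * Q (tau * x) (tau * h)) 0 1.

(** Poincare lemma along straight lines, for a form [P dx + Q dh] whose mixed
    partial derivatives are both [Ph].  Differentiating the integral over the
    ray under the integral sign produces a [tau]-derivative, by closedness,
    and integrating it leaves the value of the form at the end of the ray. *)
Lemma closed_form_exact (P Q Px Ph Qh : R -> R -> R)
  (dP : forall x h a b s,
     is_derive (fun s => P (x + s * a) (h + s * b)) s
       (a * Px (x + s * a) (h + s * b) + b * Ph (x + s * a) (h + s * b)))
  (dQ : forall x h a b s,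
     is_derive (fun s => Q (x + s * a) (h + s * b)) s
       (a * Ph (x + s * a) (h + s * b) + b * Qh (x + s * a) (h + s * b)))
  (cP : forall x h, continuity_2d_pt P x h)
  (cQ : forall x h, continuity_2d_pt Q x h)
  (cPx : forall x h, continuity_2d_pt Px x h)
  (cPh : forall x h, continuity_2d_pt Ph x h)
  (cQh : forall x h, continuity_2d_pt Qh x h)
  (x h a b s0 s1 : R) :
  is_RInt (fun s => a * P (x + s * a) (h + s * b) + b * Q (x + s * a) (h + s * b))
    s0 s1 (potential P Q (x + s1 * a) (h + s1 * b)
           - potential P Q (x + s0 * a) (h + s0 * b)).
Proof.
  set (f := fun s tau => (x + s * a) * P (tau * (x + s * a)) (tau * (h + s * b))
                  + (h + s * b) * Q (tau * (x + s * a)) (tau * (h + s * b))).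
  set (df := fun s tau =>
     a * P (tau * (x + s * a)) (tau * (h + s * b))
     + b * Q (tau * (x + s * a)) (tau * (h + s * b))
     + tau * (a * ((x + s * a) * Px (tau * (x + s * a)) (tau * (h + s * b))
                   + (h + s * b) * Ph (tau * (x + s * a)) (tau * (h + s * b)))
            + b * ((x + s * a) * Ph (tau * (x + s * a)) (tau * (h + s * b))
                   + (h + s * b) * Qh (tau * (x + s * a)) (tau * (h + s * b))))).
  assert (comp2 : forall G, (forall u v, continuity_2d_pt G u v) -> forall s tau,
    continuity_2d_pt (fun s tau => G (tau * (x + s * a)) (tau * (h + s * b))) s tau).
  { intros G HG s tau. apply continuity_2d_pt_comp2; [apply HG | |];
    (apply continuity_2d_pt_mult; [apply continuity_2d_pt_id2|];
     apply continuity_2d_pt_plus; [apply continuity_2d_pt_const|];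
     apply continuity_2d_pt_mult; [apply continuity_2d_pt_id1
       |apply continuity_2d_pt_const]). }
  assert (aff : forall c d s tau, continuity_2d_pt (fun s _ => c + s * d) s tau).
  { intros c d s tau. apply continuity_2d_pt_plus; [apply continuity_2d_pt_const|];
     apply continuity_2d_pt_mult; [apply continuity_2d_pt_id1
       |apply continuity_2d_pt_const]. }
  assert (cf : forall s tau, continuity_2d_pt f s tau).
  { intros s tau. unfold f.
    apply continuity_2d_pt_plus; (apply continuity_2d_pt_mult; [apply aff|]).
    now apply (comp2 P). now apply (comp2 Q). }
  assert (cdf : forall s tau, continuity_2d_pt df s tau).
  { intros s tau. unfold df.
    repeat first [ apply aff | apply (comp2 P), cP | apply (comp2 Q), cQ
      | apply (comp2 Px), cPx | apply (comp2 Ph), cPh | apply (comp2 Qh), cQh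
      | apply continuity_2d_pt_const | apply continuity_2d_pt_id2
      | apply continuity_2d_pt_plus | apply continuity_2d_pt_mult ]. }
  assert (ds : forall s tau, is_derive (fun s => f s tau) s (df s tau)).
  { intros s tau. unfold f.
    pose proof (dP (tau * x) (tau * h) (tau * a) (tau * b) s) as H1.
    pose proof (dQ (tau * x) (tau * h) (tau * a) (tau * b) s) as H2.
    assert (K1 : is_derive (fun s => P (tau * (x + s * a)) (tau * (h + s * b))) s
      (tau * (a * Px (tau * (x + s * a)) (tau * (h + s * b))
              + b * Ph (tau * (x + s * a)) (tau * (h + s * b))))).
    { apply (is_derive_eq _ _ _ _ _ H1).
      - intros u. f_equal; ring.
      - replace (tau * x + s * (tau * a)) with (tau * (x + s * a)) by ring.
        replace (tau * h + s * (tau * b)) with (tau * (h + s * b)) by ring.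
        ring. }
    assert (K2 : is_derive (fun s => Q (tau * (x + s * a)) (tau * (h + s * b))) s
      (tau * (a * Ph (tau * (x + s * a)) (tau * (h + s * b))
              + b * Qh (tau * (x + s * a)) (tau * (h + s * b))))).
    { apply (is_derive_eq _ _ _ _ _ H2).
      - intros u. f_equal; ring.
      - replace (tau * x + s * (tau * a)) with (tau * (x + s * a)) by ring.
        replace (tau * h + s * (tau * b)) with (tau * (h + s * b)) by ring.
        ring. }
    assert (A1 : is_derive (fun s => x + s * a) s a) by (auto_derive; auto; ring).
    assert (A2 : is_derive (fun s => h + s * b) s b) by (auto_derive; auto; ring).
    pose proof (is_derive_plus _ _ _ _ _
      (is_derive_mult _ _ _ _ _ A1 K1 Rmult_comm)
      (is_derive_mult _ _ _ _ _ A2 K2 Rmult_comm)) as H.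
    apply (is_derive_eq _ _ _ _ _ H); [reflexivity|].
    unfold df, plus, mult; simpl; ring. }
  (* closedness: the same function is a derivative in tau *)
  assert (dtau : forall s tau, is_derive (fun tau => tau *
      (a * P (tau * (x + s * a)) (tau * (h + s * b))
       + b * Q (tau * (x + s * a)) (tau * (h + s * b)))) tau (df s tau)).
  { intros s tau.
    pose proof (dP 0 0 (x + s * a) (h + s * b) tau) as H1.
    pose proof (dQ 0 0 (x + s * a) (h + s * b) tau) as H2.
    rewrite !Rplus_0_l in H1, H2.
    assert (K1 : is_derive (fun tau => P (tau * (x + s * a)) (tau * (h + s * b))) tau
       ((x + s * a) * Px (tau * (x + s * a)) (tau * (h + s * b))
              + (h + s * b) * Ph (tau * (x + s * a)) (tau * (h + s * b)))).
    { apply (is_derive_eq _ _ _ _ _ H1); [intros u; f_equal|]; ring. }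
    assert (K2 : is_derive (fun tau => Q (tau * (x + s * a)) (tau * (h + s * b))) tau
       ((x + s * a) * Ph (tau * (x + s * a)) (tau * (h + s * b))
              + (h + s * b) * Qh (tau * (x + s * a)) (tau * (h + s * b)))).
    { apply (is_derive_eq _ _ _ _ _ H2); [intros u; f_equal|]; ring. }
    pose proof (is_derive_mult _ _ _ _ _ (is_derive_id tau)
      (is_derive_plus _ _ _ _ _
      (is_derive_scal _ _ a _ K1)
      (is_derive_scal _ _ b _ K2)) Rmult_comm) as H.
    apply (is_derive_eq _ _ _ _ _ H); [reflexivity|].
    unfold df, plus, mult, scal, one, plus; simpl.
    unfold mult; simpl; ring. }
  assert (Ef : forall s, ex_RInt (fun tau => f s tau) 0 1).
  { intros s. apply (ex_RInt_continuous (V := R_CompleteNormedModule)).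
    intros tau _. now apply continuity_2d_pt_continuous_snd. }
  assert (D : forall s, is_derive
     (fun s => potential P Q (x + s * a) (h + s * b)) s
     (a * P (x + s * a) (h + s * b) + b * Q (x + s * a) (h + s * b))).
  { intros s.
    assert (DE : forall u v, Derive (fun z => f z v) u = df u v).
    { intros u v. apply is_derive_unique, ds. }
    replace (a * P (x + s * a) (h + s * b) + b * Q (x + s * a) (h + s * b))
      with (RInt (fun tau => Derive (fun u => f u tau) s) 0 1).
    - apply (is_derive_RInt_param f 0 1 s).
      + apply filter_forall. intros u tau _. eexists; apply ds.
      + intros tau _. apply continuity_2d_pt_ext with (2 := cdf s tau).
        intros u v. now rewrite DE.
      + apply filter_forall. intros u. apply Ef.
    - rewrite (RInt_ext _ (df s)) by (intros; apply DE).
      apply is_RInt_unique.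
      pose proof (is_RInt_derive (V := R_CompleteNormedModule) _ (df s) 0 1
        (fun tau _ => dtau s tau)) as H.
      match type of H with _ -> is_RInt _ _ _ ?l =>
        match goal with |- is_RInt _ _ _ ?l' => replace l' with l end end.
      + apply H. intros tau _. now apply continuity_2d_pt_continuous_snd.
      + unfold minus, plus, opp; simpl. rewrite !Rmult_1_l. ring. }
  apply (is_RInt_derive (V := R_CompleteNormedModule)
    (fun s => potential P Q (x + s * a) (h + s * b))).
  - intros s _. apply D.
  - intros s _.
    assert (C1 : forall G, (forall u v, continuity_2d_pt G u v) ->
      continuous (fun s => G (x + s * a) (h + s * b)) s).
    { intros G HG.
      apply (continuity_2d_pt_continuous_snd
        (fun _ s => G (x + s * a) (h + s * b)) 0 s).
      apply continuity_2d_pt_comp2; [apply HG | |];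
      (apply continuity_2d_pt_plus; [apply continuity_2d_pt_const|];
       apply continuity_2d_pt_mult; [apply continuity_2d_pt_id2
       |apply continuity_2d_pt_const]). }
    apply (continuous_plus (V := R_NormedModule));
    apply (continuous_mult (K := R_AbsRing)); try apply continuous_const; now apply C1.
Qed.

(** * The kernel and its primitive *)

(** The exponent [- y cosh z + (r + i t) z]. *)
Definition phase (r y t : R) (z : C) : C :=
  (- y * cosh (Re z) * cos (Im z) + r * Re z - t * Im z,
   - y * sinh (Re z) * sin (Im z) + r * Im z + t * Re z).

Definition kernel (r y t : R) (z : C) : C := Cexp (phase r y t z).

(** Real and imaginary parts of [exp (- i kappa) kernel]: with [kappa = 0] and
    [kappa = PI / 2] the real part gives both parts of the kernel, so one closed
    form serves for the real and for the imaginary part of [kernel dz]. *)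
Definition rotated_re (r y t kappa x h : R) : R :=
  exp (Re (phase r y t (x, h))) * cos (Im (phase r y t (x, h)) - kappa).
Definition rotated_im (r y t kappa x h : R) : R :=
  exp (Re (phase r y t (x, h))) * sin (Im (phase r y t (x, h)) - kappa).

Definition kernel_primitive (r y t : R) (z : C) : C :=
  (potential (rotated_re r y t 0) (fun x h => - rotated_im r y t 0 x h) (Re z) (Im z),
   potential (rotated_re r y t (PI / 2)) (fun x h => - rotated_im r y t (PI / 2) x h)
     (Re z) (Im z)).

Lemma Cexp_pair (z : C) : Cexp z = (exp (Re z) * cos (Im z), exp (Re z) * sin (Im z)).
Proof. unfold Cexp. apply injective_projections; simpl; ring. Qed.

Lemma rotated_form_exact (r y t kappa x h a b s0 s1 : R) :
  is_RInt (fun s => a * rotated_re r y t kappa (x + s * a) (h + s * b)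
                    + b * - rotated_im r y t kappa (x + s * a) (h + s * b)) s0 s1
    (potential (rotated_re r y t kappa) (fun x h => - rotated_im r y t kappa x h)
       (x + s1 * a) (h + s1 * b)
     - potential (rotated_re r y t kappa) (fun x h => - rotated_im r y t kappa x h)
       (x + s0 * a) (h + s0 * b)).
Proof.
  set (Ax := fun x h => - y * sinh x * cos h + r).
  set (Bx := fun x h => - y * cosh x * sin h + t).
  apply (closed_form_exact (rotated_re r y t kappa)
    (fun x h => - rotated_im r y t kappa x h)
    (fun x h => rotated_re r y t kappa x h * Ax x h - rotated_im r y t kappa x h * Bx x h)
    (fun x h => - (rotated_re r y t kappa x h * Bx x h + rotated_im r y t kappa x h * Ax x h))
    (fun x h => - (rotated_re r y t kappa x h * Ax x h - rotated_im r y t kappa x h * Bx x h)));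
  unfold rotated_re, rotated_im, phase, Ax, Bx; simpl;
  try (intros u v; continuity_2d).
  all: intros; auto_derive; auto.
  all: unfold Rminus; ring.
Qed.

(** Cauchy's theorem in the form used below: the integral of [kernel] along a
    straight path depends on its endpoints only. *)
Lemma is_RInt_kernel (r y t : R) (z w : C) (s0 s1 : R) :
  is_RInt (V := C_R_NormedModule) (fun s => w * kernel r y t (z + RtoC s * w))%C s0 s1
    (kernel_primitive r y t (z + RtoC s1 * w) - kernel_primitive r y t (z + RtoC s0 * w))%C.
Proof.
  destruct z as [x h], w as [a b].
  assert (L : forall s, ((x, h) + RtoC s * (a, b))%C = (x + s * a, h + s * b)).
  { intros s. apply injective_projections; simpl; ring. }
  rewrite !L. unfold kernel.
  apply (is_RInt_fct_extend_pair (U := R_NormedModule) (V := R_NormedModule)).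
  - apply is_RInt_ext with (2 := rotated_form_exact r y t 0 x h a b s0 s1).
    intros s _. rewrite L, Cexp_pair. unfold rotated_re, rotated_im; simpl.
    rewrite !Rminus_0_r. ring.
  - apply is_RInt_ext with (2 := rotated_form_exact r y t (PI / 2) x h a b s0 s1).
    intros s _. rewrite L, Cexp_pair. unfold rotated_re, rotated_im.
    simpl. rewrite cos_minus, sin_minus, cos_PI2, sin_PI2. ring.
Qed.

Lemma sinh_opp x : sinh (- x) = - sinh x.
Proof. unfold sinh. rewrite Ropp_involutive. field. Qed.
Lemma cosh_opp x : cosh (- x) = cosh x.
Proof. unfold cosh. rewrite Ropp_involutive. field. Qed.

(** On the reflected point the hyperbolic cosine is conjugated, [i t z] too, and
    [r z] becomes the conjugate of [- r z]. *)
Lemma kernel_reflect (r y t : R) (z : C) :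
  kernel r y t (- Cconj z)%C = Cconj (kernel (- r) y t z).
Proof.
  destruct z as [x h]. unfold kernel. rewrite !Cexp_pair.
  unfold phase; simpl. rewrite cosh_opp, sinh_opp, Ropp_involutive.
  unfold Cconj; simpl.
  replace (- y * - sinh x * sin h + r * h + t * - x)
    with (- (- y * sinh x * sin h + - r * h + t * x)) by ring.
  rewrite cos_neg, sin_neg.
  apply injective_projections; simpl; [f_equal; f_equal; ring|].
  rewrite <- Ropp_mult_distr_r. f_equal. f_equal. f_equal. ring.
Qed.

Lemma is_RInt_conj (f : R -> C) (a b : R) (l : C) :
  is_RInt (V := C_R_NormedModule) f a b l ->
  is_RInt (V := C_R_NormedModule) (fun x => Cconj (f x)) a b (Cconj l).
Proof.
  intros H.
  apply (is_RInt_fct_extend_pair (U := R_NormedModule) (V := R_NormedModule)); simpl.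
  - exact (is_RInt_fct_extend_fst _ _ _ _ H).
  - apply (is_RInt_opp (V := R_NormedModule)).
    exact (is_RInt_fct_extend_snd _ _ _ _ H).
Qed.

Lemma potential_0 (P Q : R -> R -> R) : potential P Q 0 0 = 0.
Proof.
  unfold potential. rewrite (RInt_ext _ (fun _ => 0)) by (intros s _; simpl; ring).
  rewrite (RInt_const (V := R_CompleteNormedModule)).
  unfold scal; simpl; unfold mult; simpl. ring.
Qed.

Lemma kernel_primitive_ray (r y t : R) (z : C) :
  is_RInt (V := C_R_NormedModule) (fun s => z * kernel r y t (RtoC s * z))%C 0 1
    (kernel_primitive r y t z).
Proof.
  pose proof (is_RInt_kernel r y t 0 z 0 1) as H.
  replace (0 + RtoC 1 * z)%C with z in H by ring.
  replace (0 + RtoC 0 * z)%C with (RtoC 0) in H by ring.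
  assert (Z : kernel_primitive r y t 0 = 0%C).
  { unfold kernel_primitive; simpl. now rewrite !potential_0. }
  rewrite Z in H. replace (kernel_primitive r y t z - 0)%C with (kernel_primitive r y t z) in H by ring.
  apply is_RInt_ext with (2 := H).
  intros s _. now rewrite Cplus_0_l.
Qed.

(** The ray towards [- conj z] is the reflection of the ray towards [z]. *)
Lemma kernel_primitive_reflect (r y t : R) (z : C) :
  kernel_primitive r y t (- Cconj z)%C = (- Cconj (kernel_primitive (- r) y t z))%C.
Proof.
  pose proof (is_RInt_opp _ _ _ _ (is_RInt_conj _ _ _ _ (kernel_primitive_ray (- r) y t z))) as H.
  rewrite <- (is_RInt_unique (V := C_R_CompleteNormedModule) _ _ _ _
     (kernel_primitive_ray r y t (- Cconj z)%C)).
  apply (is_RInt_unique (V := C_R_CompleteNormedModule)).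
  apply (is_RInt_ext (V := C_R_NormedModule)) with (2 := H).
  intros s _.
  replace (RtoC s * - Cconj z)%C with (- Cconj (RtoC s * z))%C.
  - rewrite kernel_reflect, Cmult_conj. unfold opp; simpl. 
    apply injective_projections; simpl; unfold opp; simpl; ring.
  - rewrite Cmult_conj. replace (Cconj (RtoC s)) with (RtoC s); [ring|].
    apply injective_projections; simpl; ring.
Qed.

(** * Estimates for the complex exponential *)

Lemma norm_Cmod (z : C) : norm (z : C_R_NormedModule) = Cmod z.
Proof.
  destruct z as [a b]. unfold Cmod. simpl.
  unfold norm; simpl. unfold prod_norm, norm; simpl. unfold abs; simpl.
  f_equal. rewrite !Rmult_1_r. f_equal; apply (eq_sym (Rsqr_abs _)).
Qed.

Lemma Cmod_le_add (a b : R) : Cmod (a, b) <= Rabs a + Rabs b.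
Proof.
  replace ((a, b) : C) with (RtoC a + Ci * RtoC b)%C
    by (apply injective_projections; simpl; ring).
  eapply Rle_trans; [apply Cmod_triangle|].
  rewrite Cmod_mult, !Cmod_R, Cmod_Ci. lra.
Qed.

Lemma im_le_Cmod (z : C) : Rabs (Im z) <= Cmod z.
Proof. eapply Rle_trans; [|apply Rmax_Cmod]. apply Rmax_r. Qed.

Lemma Cexp_plus (z w : C) : Cexp (z + w)%C = (Cexp z * Cexp w)%C.
Proof.
  rewrite !Cexp_pair. destruct z as [a b], w as [c d]; simpl.
  rewrite exp_plus, cos_plus, sin_plus.
  apply injective_projections; simpl; ring.
Qed.

Lemma Cexp_0 : Cexp 0 = 1%C.
Proof.
  rewrite Cexp_pair; simpl. rewrite exp_0, cos_0, sin_0.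
  apply injective_projections; simpl; ring.
Qed.

Lemma Cmod_Cexp (z : C) : Cmod (Cexp z) = exp (Re z).
Proof.
  rewrite Cexp_pair. unfold Cmod; simpl.
  transitivity (sqrt (Rsqr (exp (Re z)))); [|apply sqrt_Rsqr; left; apply exp_pos].
  f_equal. pose proof (sin2_cos2 (Im z)) as H. unfold Rsqr in *.
  transitivity (exp (Re z) * exp (Re z) *
    (sin (Im z) * sin (Im z) + cos (Im z) * cos (Im z))); [ring|].
  rewrite H. ring.
Qed.

Lemma exp_le_compat (a b : R) : a <= b -> exp a <= exp b.
Proof. intros [H| ->]; [left; now apply exp_increasing | right; reflexivity]. Qed.

Lemma Cmod_Cexp_le (z : C) : Cmod (Cexp z) <= exp (Cmod z).
Proof.
  rewrite Cmod_Cexp. apply exp_le_compat.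
  eapply Rle_trans; [apply Rle_abs | apply re_le_Cmod].
Qed.

Lemma increment_le (f df : R -> R) (x K : R) :
  (forall u, Rabs u <= Rabs x -> is_derive f u (df u)) ->
  (forall u, Rabs u <= Rabs x -> Rabs (df u) <= K) ->
  Rabs (f x - f 0) <= K * Rabs x.
Proof.
  intros Hd HK.
  destruct (MVT_cor4 f df 0 (Rabs x)) with (b := x) as [c [E Hc]].
  - intros c Hc. apply Hd. now rewrite Rminus_0_r in Hc.
  - rewrite Rminus_0_r. lra.
  - rewrite Rminus_0_r in E, Hc. rewrite Rminus_0_r in Hc.
    rewrite E, Rabs_mult. apply Rmult_le_compat_r; [apply Rabs_pos|]. now apply HK.
Qed.

Lemma Cexp_sub1_le (z : C) : Cmod (Cexp z - 1)%C <= 3 * Cmod z * exp (Cmod z).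
Proof.
  set (m := Cmod z).
  assert (Ha : Rabs (Re z) <= m) by apply re_le_Cmod.
  assert (Hb : Rabs (Im z) <= m) by apply im_le_Cmod.
  assert (Hm : 0 <= m) by apply Cmod_ge_0.
  rewrite Cexp_pair. set (a := Re z) in *. set (b := Im z) in *.
  replace (Cminus (exp a * cos b, exp a * sin b) 1)
    with ((exp a * (cos b - 1) + (exp a - 1), exp a * sin b) : C)
    by (apply injective_projections; simpl; ring).
  assert (E : 0 < exp a <= exp m).
  { split; [apply exp_pos|]. apply exp_le_compat.
    eapply Rle_trans; [apply Rle_abs|exact Ha]. }
  assert (H1 : Rabs (exp a - 1) <= exp m * m).
  { rewrite <- exp_0.
    eapply Rle_trans; [apply (increment_le exp exp a (exp m))|].
    - intros u _. auto_derive; auto; ring.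
    - intros u Hu. rewrite Rabs_pos_eq by (left; apply exp_pos).
      apply exp_le_compat. eapply Rle_trans; [apply Rle_abs|lra].
    - apply Rmult_le_compat_l; [left; apply exp_pos | exact Ha]. }
  assert (H2 : Rabs (cos b - 1) <= m).
  { rewrite <- cos_0.
    eapply Rle_trans; [apply (increment_le cos (fun u => - sin u) b 1)|].
    - intros u _. auto_derive; auto; ring.
    - intros u _. rewrite Rabs_Ropp. apply Rabs_le, SIN_bound.
    - lra. }
  assert (H3 : Rabs (sin b) <= m).
  { replace (sin b) with (sin b - sin 0) by (rewrite sin_0; ring).
    eapply Rle_trans; [apply (increment_le sin cos b 1)|].
    - intros u _. auto_derive; auto; ring.
    - intros u _. apply Rabs_le, COS_bound.
    - lra. }
  eapply Rle_trans; [apply Cmod_le_add|].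
  pose proof (Rabs_triang (exp a * (cos b - 1)) (exp a - 1)) as T.
  rewrite !Rabs_mult, !(Rabs_pos_eq (exp a)) in * by lra.
  assert (exp a * Rabs (cos b - 1) <= exp m * m)
    by (apply Rmult_le_compat; try apply Rabs_pos; lra).
  assert (exp a * Rabs (sin b) <= exp m * m)
    by (apply Rmult_le_compat; try apply Rabs_pos; lra).
  lra.
Qed.

(** [exp z + exp (- z) - 2 = exp (- z) (exp z - 1)^2] is of second order. *)
Lemma Cexp_even_le (z : C) :
  Cmod (Cexp z + Cexp (- z) - 2)%C <= 9 * Cmod z ^ 2 * exp (3 * Cmod z).
Proof.
  assert (E : (Cexp z * Cexp (- z))%C = 1%C).
  { rewrite <- Cexp_plus, <- Cexp_0. f_equal. ring. }
  replace (Cexp z + Cexp (- z) - 2)%C with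
    (Cexp (- z) * ((Cexp z - 1) * (Cexp z - 1)))%C.
  2:{ replace (Cexp (- z) * ((Cexp z - 1) * (Cexp z - 1)))%C with
       (Cexp z * (Cexp z * Cexp (- z)) - 2 * (Cexp z * Cexp (-z)) + Cexp (-z))%C by ring.
      rewrite E. ring. }
  rewrite !Cmod_mult.
  pose proof (Cmod_Cexp_le (- z)%C) as H1. rewrite Cmod_opp in H1.
  pose proof (Cexp_sub1_le z) as H2.
  replace (3 * Cmod z) with (Cmod z + (Cmod z + Cmod z)) by ring.
  rewrite !exp_plus.
  replace (9 * Cmod z ^ 2 * (exp (Cmod z) * (exp (Cmod z) * exp (Cmod z)))) with
    (exp (Cmod z) * ((3 * Cmod z * exp (Cmod z)) * (3 * Cmod z * exp (Cmod z)))) by ring.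
  apply Rmult_le_compat; auto using Cmod_ge_0.
  - apply Rmult_le_pos; apply Cmod_ge_0.
  - apply Rmult_le_compat; auto using Cmod_ge_0.
Qed.

(** Symmetrisation: the part [o] of the exponent that changes sign enters only
    quadratically. *)
Lemma Cexp_sym_le (e o : C) :
  Cmod (Cexp (e + o) + Cexp (e - o) - 2)%C
  <= (9 * Cmod o ^ 2 + 6 * Cmod e) * exp (Cmod e + 3 * Cmod o).
Proof.
  replace (Cexp (e + o) + Cexp (e - o) - 2)%C with
    (Cexp e * (Cexp o + Cexp (- o) - 2) + 2 * (Cexp e - 1))%C.
  2:{ unfold Cminus at 4. rewrite !Cexp_plus. ring. }
  eapply Rle_trans; [apply Cmod_triangle|]. rewrite !Cmod_mult.
  pose proof (Cmod_Cexp_le e) as H1. pose proof (Cexp_even_le o) as H2.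
  pose proof (Cexp_sub1_le e) as H3.
  pose proof (Cmod_ge_0 e). pose proof (Cmod_ge_0 o).
  replace (Cmod 2) with 2 by (rewrite Cmod_R, Rabs_pos_eq; lra).
  rewrite Rmult_plus_distr_r. apply Rplus_le_compat.
  - rewrite exp_plus.
    replace (9 * Cmod o ^ 2 * (exp (Cmod e) * exp (3 * Cmod o)))
      with (exp (Cmod e) * (9 * Cmod o ^ 2 * exp (3 * Cmod o))) by ring.
    apply Rmult_le_compat; auto using Cmod_ge_0.
  - apply Rle_trans with (6 * Cmod e * exp (Cmod e)); [lra|].
    apply Rmult_le_compat_l; [lra|]. apply exp_le_compat. lra.
Qed.

(** * The Gaussian integral over a bounded interval *)

Lemma is_derive_RInt_0 (f : R -> R) (x : R) :
  (forall u, continuous f u) -> is_derive (fun x => RInt f 0 x) x (f x).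
Proof.
  intros Hf. apply is_derive_RInt with 0.
  - apply filter_forall. intros u. apply (RInt_correct (V := R_CompleteNormedModule)).
    apply (ex_RInt_continuous (V := R_CompleteNormedModule)). auto.
  - auto.
Qed.

Definition gauss (x : R) : R := RInt (fun s => exp (- (s * s))) 0 x.

(** The derivatives in [x] of the two terms cancel, after the substitution
    [s = x v] in the second one; at [x = 0] the sum is [atan 1]. *)
Lemma gauss_identity (x : R) :
  gauss x * gauss x
  + RInt (fun v => exp (- (x * x * (1 + v * v))) / (1 + v * v)) 0 1 = PI / 4.
Proof.
  set (f := fun x v => exp (- (x * x * (1 + v * v))) / (1 + v * v)).
  set (df := fun x v => - (2 * x) * exp (- (x * x * (1 + v * v)))).
  assert (pos : forall v, 1 + v * v <> 0) by (intros v; nra).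
  assert (D1 : forall x v, is_derive (fun x => f x v) x (df x v)).
  { intros u v. unfold f, df. auto_derive; [auto|]. field. apply pos. }
  assert (cg : forall u, continuous (fun s => exp (- (s * s))) u).
  { intros u. apply (ex_derive_continuous (V := R_NormedModule)).
    auto_derive; auto. }
  assert (D : forall x, is_derive (fun x => gauss x * gauss x + RInt (f x) 0 1) x 0).
  { intros u.
    assert (I : is_derive (fun x => RInt (f x) 0 1) u
       (- 2 * exp (- (u * u)) * gauss u)).
    { replace (- 2 * exp (- (u * u)) * gauss u) with
        (RInt (fun v => Derive (fun z => f z v) u) 0 1).
      - apply (is_derive_RInt_param f 0 1 u).
        + apply filter_forall. intros z v _. eexists; apply D1.
        + intros v _. apply continuity_2d_pt_ext with (f := df).
          { intros p q. symmetry. apply is_derive_unique, D1. }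
          unfold df. continuity_2d.
        + apply filter_forall. intros z.
          apply (ex_RInt_continuous (V := R_CompleteNormedModule)).
          intros v _. apply (ex_derive_continuous (V := R_NormedModule)).
          unfold f. auto_derive. apply pos.
      - rewrite (RInt_ext _ (fun v => scal (- 2 * exp (- (u * u)))
           (scal u (exp (- ((u * v + 0) * (u * v + 0))))))).
        2:{ intros v _. transitivity (df u v); [apply is_derive_unique, D1|]. unfold df.
            unfold scal; simpl; unfold mult; simpl.
            replace (- (u * u * (1 + v * v))) with
              (- (u * u) + - ((u * v + 0) * (u * v + 0))) by ring.
            rewrite exp_plus. ring. }
        rewrite (RInt_scal (V := R_CompleteNormedModule)).
        + unfold scal at 1; simpl; unfold mult; simpl. f_equal.
          rewrite (RInt_comp_lin (V := R_CompleteNormedModule)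
            (fun s => exp (- (s * s)))).
          * unfold gauss. f_equal; ring.
          * apply (ex_RInt_continuous (V := R_CompleteNormedModule)). auto.
        + apply (ex_RInt_continuous (V := R_CompleteNormedModule)).
          intros v _. apply (ex_derive_continuous (V := R_NormedModule)).
          unfold scal; simpl; unfold mult; simpl. auto_derive; auto. }
    assert (G : is_derive gauss u (exp (- (u * u)))) by exact (is_derive_RInt_0 _ u cg).
    apply (is_derive_eq _ _ _ _ _ (is_derive_plus _ _ _ _ _
      (is_derive_mult _ _ _ _ _ G G Rmult_comm) I)); [reflexivity|].
    unfold plus, mult; simpl. ring. }
  assert (Z : gauss 0 * gauss 0 + RInt (f 0) 0 1 = PI / 4).
  { unfold gauss. rewrite (RInt_point (V := R_CompleteNormedModule)).
    unfold zero; simpl. rewrite Rmult_0_l, Rplus_0_l, <- atan_1.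
    apply (is_RInt_unique (V := R_CompleteNormedModule)).
    replace (atan 1) with (minus (atan 1) (atan 0))
      by (rewrite atan_0; unfold minus, plus, opp; simpl; ring).
    apply is_RInt_ext with (f := fun v => / (1 + v²)).
    { intros v _. unfold f, Rsqr. rewrite !Rmult_0_l, Ropp_0, exp_0.
      apply eq_sym, Rmult_1_l. }
    apply (is_RInt_derive (V := R_CompleteNormedModule)).
    - intros v _. apply is_derive_atan.
    - intros v _. apply (ex_derive_continuous (V := R_NormedModule)).
      unfold Rsqr. auto_derive. apply pos. }
  change (gauss x * gauss x + RInt (f x) 0 1 = PI / 4). rewrite <- Z.
  destruct (MVT_gen (fun x => gauss x * gauss x + RInt (f x) 0 1) 0 x (fun _ => 0))
    as [c [_ E]].
  - intros u _. apply D.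
  - intros u _. apply continuity_pt_filterlim.
    apply (ex_derive_continuous (V := R_NormedModule)
      (fun x => gauss x * gauss x + RInt (f x) 0 1)). exists 0. apply D.
  - cbv beta in E. lra.
Qed.

(** The second term of [gauss_identity] lies between 0 and [exp (- x^2)]. *)
Lemma gauss_bound (x : R) :
  0 <= x -> sqrt PI / 2 - 2 * exp (- (x * x)) <= gauss x <= sqrt PI / 2.
Proof.
  intros Hx.
  assert (G0 : 0 <= gauss x).
  { apply RInt_ge_0; auto.
    - apply (ex_RInt_continuous (V := R_CompleteNormedModule)).
      intros v _. apply (ex_derive_continuous (V := R_NormedModule)).
      auto_derive; auto.
    - intros v _. left; apply exp_pos. }
  pose proof (gauss_identity x) as E.
  set (J := RInt _ _ _) in E.
  assert (exJ : ex_RInt (fun v => exp (- (x * x * (1 + v * v))) / (1 + v * v)) 0 1).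
  { apply (ex_RInt_continuous (V := R_CompleteNormedModule)).
    intros v _. apply (ex_derive_continuous (V := R_NormedModule)).
    auto_derive. nra. }
  assert (J0 : 0 <= J).
  { apply RInt_ge_0; auto; [lra|].
    intros v _. left; apply Rdiv_lt_0_compat; [apply exp_pos | nra]. }
  assert (J1 : J <= exp (- (x * x))).
  { replace (exp (- (x * x))) with (RInt (fun _ => exp (- (x * x))) 0 1).
    - apply RInt_le; auto; [lra | apply ex_RInt_const |].
      intros v _. apply Rle_div_l; [nra|].
      apply Rle_trans with (exp (- (x * x)) * 1).
      + rewrite Rmult_1_r. apply exp_le_compat. nra.
      + apply Rmult_le_compat_l; [left; apply exp_pos | nra].
    - rewrite (RInt_const (V := R_CompleteNormedModule)).
      unfold scal; simpl; unfold mult; simpl. ring. }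
  pose proof PI_RGT_0. pose proof PI2_1.
  pose proof (sqrt_pos PI) as S0. pose proof (sqrt_sqrt PI ltac:(lra)) as S.
  assert (1 <= sqrt PI) by (rewrite <- sqrt_1; apply sqrt_le_1; lra).
  split; [|nra].
  assert (sqrt PI / 2 - gauss x <= 2 * J); [|lra].
  assert ((sqrt PI / 2 - gauss x) * (sqrt PI / 2 + gauss x) = J) by nra.
  nra.
Qed.

Lemma gauss_scaled (c d : R) :
  0 < c -> 0 <= d ->
  exists I, is_RInt (fun s => exp (- (c * s * s))) 0 d I /\
    0 <= I <= sqrt (PI / c) / 2 /\
    Rabs (I - sqrt (PI / c) / 2) <= 2 * exp (- (c * d * d)) / sqrt c.
Proof.
  intros Hc Hd. assert (Hs : 0 < sqrt c) by now apply sqrt_lt_R0.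
  pose proof (sqrt_sqrt c ltac:(lra)) as Es.
  exists (/ sqrt c * gauss (sqrt c * d)).
  assert (B := gauss_bound (sqrt c * d) ltac:(nra)).
  replace (sqrt c * d * (sqrt c * d)) with (c * d * d) in B by (rewrite <- Es at 1; ring).
  rewrite sqrt_div_alt by assumption.
  assert (Hi : 0 < / sqrt c) by now apply Rinv_0_lt_compat.
  assert (G0 : 0 <= gauss (sqrt c * d)).
  { apply RInt_ge_0; [nra | | intros v _; left; apply exp_pos].
    apply (ex_RInt_continuous (V := R_CompleteNormedModule)).
    intros v _. apply (ex_derive_continuous (V := R_NormedModule)).
    auto_derive; auto. }
  split; [|split].
  - apply is_RInt_ext with (f := fun s => scal (/ sqrt c)
      (scal (sqrt c) (exp (- ((sqrt c * s + 0) * (sqrt c * s + 0)))))).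
    { intros s _. unfold scal; simpl; unfold mult; simpl.
      rewrite <- Rmult_assoc, Rinv_l, Rmult_1_l by lra.
      f_equal. rewrite <- Es at 3. ring. }
    apply (is_RInt_scal (V := R_NormedModule)).
    apply (is_RInt_comp_lin (V := R_NormedModule) (fun s => exp (- (s * s)))).
    rewrite Rmult_0_r, !Rplus_0_r.
    apply (RInt_correct (V := R_CompleteNormedModule)).
    apply (ex_RInt_continuous (V := R_CompleteNormedModule)).
    intros v _. apply (ex_derive_continuous (V := R_NormedModule)).
    auto_derive; auto.
  - split; [nra|]. unfold Rdiv. nra.
  - replace (/ sqrt c * gauss (sqrt c * d) - sqrt PI / sqrt c / 2)
      with (/ sqrt c * (gauss (sqrt c * d) - sqrt PI / 2)) by (field; lra).
    rewrite Rabs_mult, (Rabs_pos_eq (/ sqrt c)) by lra.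
    unfold Rdiv. rewrite (Rmult_comm _ (/ sqrt c)).
    apply Rmult_le_compat_l; [lra|].
    apply Rabs_le. lra.
Qed.

(** * The segment through the saddle point *)

Lemma cosh_plus a b : cosh (a + b) = cosh a * cosh b + sinh a * sinh b.
Proof. unfold cosh, sinh. rewrite Ropp_plus_distr, !exp_plus. field. Qed.
Lemma sinh_plus a b : sinh (a + b) = sinh a * cosh b + cosh a * sinh b.
Proof. unfold cosh, sinh. rewrite Ropp_plus_distr, !exp_plus. field. Qed.

Lemma Rabs_sin_le x : Rabs (sin x) <= Rabs x.
Proof.
  replace (sin x) with (sin x - sin 0) by (rewrite sin_0; ring).
  rewrite <- (Rmult_1_l (Rabs x)). apply (increment_le sin cos).
  - intros u _. auto_derive; auto; ring.
  - intros u _. apply Rabs_le, COS_bound.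
Qed.

Lemma Rabs_sinh_le x : Rabs x <= 1 -> Rabs (sinh x) <= 2 * Rabs x.
Proof.
  intros Hx.
  replace (sinh x) with (sinh x - sinh 0) by (unfold sinh; rewrite Ropp_0; lra).
  apply (increment_le sinh cosh).
  - intros u _. auto_derive; auto; ring.
  - intros u Hu.
    assert (- 1 <= u <= 1) by (apply Rabs_le_between; lra).
    pose proof exp_le_3. pose proof (exp_pos u). pose proof (exp_pos (- u)).
    destruct (Rle_dec 0 u).
    + assert (exp u <= exp 1) by (apply exp_le_compat; lra).
      assert (exp (- u) <= exp 0) by (apply exp_le_compat; lra).
      rewrite exp_0 in *. unfold cosh. apply Rabs_le. lra.
    + assert (exp (- u) <= exp 1) by (apply exp_le_compat; lra).
      assert (exp u <= exp 0) by (apply exp_le_compat; lra).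
      rewrite exp_0 in *. unfold cosh. apply Rabs_le. lra.
Qed.

(** One step of a Taylor estimate: it raises the order of vanishing by one, and
    is iterated below instead of computing remainders. *)
Lemma increment_pow_le (f df : R -> R) (K : R) (n : nat) :
  f 0 = 0 -> 0 <= K ->
  (forall u, is_derive f u (df u)) ->
  (forall u, Rabs u <= 1 -> Rabs (df u) <= K * Rabs u ^ n) ->
  forall x, Rabs x <= 1 -> Rabs (f x) <= K * Rabs x ^ S n.
Proof.
  intros f0 K0 Hd HK x Hx.
  replace (f x) with (f x - f 0) by (rewrite f0; ring).
  replace (K * Rabs x ^ S n) with (K * Rabs x ^ n * Rabs x) by (simpl; ring).
  apply (increment_le f df); [auto|].
  intros u Hu. eapply Rle_trans; [apply HK; lra|].
  apply Rmult_le_compat_l; [exact K0|]. apply pow_incr. split; [apply Rabs_pos|exact Hu].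
Qed.

Lemma sinh_0 : sinh 0 = 0.
Proof. unfold sinh. rewrite Ropp_0. lra. Qed.

Ltac at_zero := rewrite ?sinh_0, ?cosh_0, ?cos_0, ?sin_0; ring.

(** For [v = (1 - i) x] these are the remainders of the expansions of [cosh v]
    and [sinh v] at the origin, separated into real and imaginary parts. *)
Lemma saddle_taylor (x : R) : Rabs x <= 1 ->
  Rabs (cosh x * cos x - 1) <= 4 * Rabs x ^ 4 /\
  Rabs (sinh x * sin x - x ^ 2) <= 12 * Rabs x ^ 4 /\
  Rabs (cosh x * sin x - x) <= 6 * Rabs x ^ 3 /\
  Rabs (sinh x * cos x - x) <= 6 * Rabs x ^ 3.
Proof.
  assert (Q : forall u, Rabs u <= 1 -> Rabs (sinh u * sin u) <= 2 * Rabs u ^ 2).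
  { intros u Hu. rewrite Rabs_mult.
    replace (2 * Rabs u ^ 2) with (2 * Rabs u * Rabs u) by ring.
    apply Rmult_le_compat; auto using Rabs_pos, Rabs_sin_le, Rabs_sinh_le. }
  assert (Q1 : forall u, Rabs u <= 1 ->
     Rabs (sinh u * cos u - cosh u * sin u) <= 4 * Rabs u ^ 3).
  { apply (increment_pow_le _ (fun u => - 2 * (sinh u * sin u))); [at_zero|lra|..].
    - intros u. auto_derive; auto; ring.
    - intros u Hu. specialize (Q u Hu). rewrite Rabs_mult, (Rabs_left (-2)) by lra. lra. }
  assert (Q2 : forall u, Rabs u <= 1 -> Rabs (cosh u * cos u - 1) <= 4 * Rabs u ^ 4).
  { apply (increment_pow_le _ (fun u => sinh u * cos u - cosh u * sin u));
      [at_zero|lra| |exact Q1].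
    intros u. auto_derive; auto; ring. }
  assert (P4 : forall u, Rabs u <= 1 -> Rabs u ^ 4 <= Rabs u ^ 2).
  { intros u Hu. pose proof (Rabs_pos u).
    replace (Rabs u ^ 4) with (Rabs u ^ 2 * Rabs u ^ 2) by ring.
    assert (Rabs u ^ 2 <= 1) by nra. pose proof (pow2_ge_0 (Rabs u)). nra. }
  assert (Q3 : forall u, Rabs u <= 1 -> Rabs (cosh u * sin u - u) <= 6 * Rabs u ^ 3).
  { apply (increment_pow_le _ (fun u => (cosh u * cos u - 1) + sinh u * sin u));
      [at_zero|lra| |].
    - intros u. auto_derive; auto; ring.
    - intros u Hu. specialize (Q u Hu). specialize (Q2 u Hu). specialize (P4 u Hu).
      eapply Rle_trans; [apply Rabs_triang|]. lra. }
  assert (Q4 : forall u, Rabs u <= 1 -> Rabs (sinh u * cos u - u) <= 6 * Rabs u ^ 3).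
  { apply (increment_pow_le _ (fun u => (cosh u * cos u - 1) + - (sinh u * sin u)));
      [at_zero|lra| |].
    - intros u. auto_derive; auto; ring.
    - intros u Hu. specialize (Q u Hu). specialize (Q2 u Hu). specialize (P4 u Hu).
      eapply Rle_trans; [apply Rabs_triang|]. rewrite Rabs_Ropp. lra. }
  assert (Q5 : forall u, Rabs u <= 1 -> Rabs (sinh u * sin u - u ^ 2) <= 12 * Rabs u ^ 4).
  { apply (increment_pow_le _ (fun u => (cosh u * sin u - u) + (sinh u * cos u - u)));
      [at_zero|lra| |].
    - intros u. auto_derive; auto; ring.
    - intros u Hu. specialize (Q3 u Hu). specialize (Q4 u Hu).
      eapply Rle_trans; [apply Rabs_triang|]. lra. }
  intros Hx. auto.
Qed.

(** On the path [saddle + s (1 - i)] the exponent is its value at the saddle,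
    plus [- y sinh mu s^2], plus the following two functions, the first even
    in [s] and of order [y s^4], the second odd and of order [y s^3 + r s]. *)
Definition even_rest (y mu s : R) : C :=
  (- y * sinh mu * (sinh s * sin s - s ^ 2), - y * sinh mu * (cosh s * cos s - 1)).
Definition odd_rest (r y mu s : R) : C :=
  (- y * cosh mu * (cosh s * sin s - s) + r * s,
   - y * cosh mu * (sinh s * cos s - s) - r * s).

Definition saddle (mu : R) : C := (mu, PI / 2).

Lemma phase_saddle (r y mu s : R) :
  phase r y (y * cosh mu) (saddle mu + RtoC s * (1, -1))%C
  = (phase r y (y * cosh mu) (saddle mu) + RtoC (- (y * sinh mu * s * s))
     + (even_rest y mu s + odd_rest r y mu s))%C.
Proof.
  unfold phase, even_rest, odd_rest, saddle; simpl.
  replace (PI / 2 + (s * -1 + 0 * 1)) with (PI / 2 - s) by ring.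
  replace (mu + (s * 1 - 0 * -1)) with (mu + s) by ring.
  rewrite cosh_plus, sinh_plus, cos_shift, sin_shift, cos_PI2, sin_PI2.
  apply injective_projections; simpl; ring.
Qed.

Lemma phase_saddle_opp (r y mu s : R) :
  phase r y (y * cosh mu) (saddle mu + RtoC s * - (1, -1))%C
  = (phase r y (y * cosh mu) (saddle mu) + RtoC (- (y * sinh mu * s * s))
     + (even_rest y mu s - odd_rest r y mu s))%C.
Proof.
  unfold phase, even_rest, odd_rest, saddle; simpl.
  replace (PI / 2 + (s * - -1 + 0 * - (1))) with (PI / 2 - - s) by ring.
  replace (mu + (s * -(1) - 0 * - -1)) with (mu + - s) by ring.
  rewrite cosh_plus, sinh_plus, cos_shift, sin_shift, cos_PI2, sin_PI2.
  rewrite cos_neg, sin_neg, cosh_opp, sinh_opp.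
  apply injective_projections; simpl; ring.
Qed.

(** The constant is [12 + 12^2 + 12^3], from [p / 12 <= exp (p / 12)]. *)
Lemma poly_le_exp (p : R) : 0 <= p -> p + p ^ 2 + p ^ 3 <= 1884 * exp (p / 4).
Proof.
  intros Hp. set (e := exp (p / 12)).
  assert (H1 : p / 12 <= e) by (unfold e; pose proof (exp_ineq1_le (p / 12)); lra).
  assert (H2 : 1 <= e) by (unfold e; pose proof (exp_ineq1_le (p / 12)); lra).
  replace (exp (p / 4)) with (e ^ 3).
  2:{ unfold e. simpl. rewrite Rmult_1_r, <- !exp_plus. f_equal. field. }
  assert (p <= 12 * e) by lra.
  assert (p ^ 2 <= (12 * e) ^ 2) by (apply pow_incr; lra).
  assert (p ^ 3 <= (12 * e) ^ 3) by (apply pow_incr; lra).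
  assert (1 * e <= e * e) by nra. nra.
Qed.

(** Half the extent, in the real direction, of the segment through the saddle:
    so small that on it the cubic part of the exponent, of size
    [y cosh mu s^3], is a small fraction of the quadratic part. *)
Definition half_width (mu : R) : R := sinh mu / (100 * cosh mu).

Lemma sinh_pos mu : 0 < mu -> 0 < sinh mu.
Proof.
  intros H. unfold sinh. assert (exp (- mu) < exp mu) by (apply exp_increasing; lra). lra.
Qed.

Lemma cosh_pos x : 0 < cosh x.
Proof. unfold cosh. pose proof (exp_pos x). pose proof (exp_pos (- x)). lra. Qed.

Lemma sinh_lt_cosh x : sinh x < cosh x.
Proof. unfold cosh, sinh. pose proof (exp_pos (- x)). lra. Qed.

Lemma half_width_bound mu : 0 < mu -> 0 < half_width mu < / 100.
Proof.
  intros H. pose proof (sinh_pos mu H). pose proof (cosh_pos mu). pose proof (sinh_lt_cosh mu).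
  unfold half_width. split.
  - apply Rdiv_lt_0_compat; lra.
  - apply Rlt_div_l; [lra|]. lra.
Qed.

(** Set [p = y sinh mu s^2].  By [Cexp_sym_le] the left factor is at most
    [(1/y) (p + p^2 + p^3) exp (p / 2)] up to a constant, because the length of
    the segment is chosen so that the rest of the exponent is at most [p / 2]
    up to a constant; [exp (- p)] absorbs this and leaves [exp (- p / 4)]. *)
Lemma saddle_pointwise (M mu : R) : 0 <= M -> 0 < mu ->
  exists K, 0 <= K /\ forall r y s, Rabs r <= M -> 0 < y -> 0 <= s <= half_width mu ->
   Cmod (Cexp (even_rest y mu s + odd_rest r y mu s)
         + Cexp (even_rest y mu s - odd_rest r y mu s) - 2)%C
     * exp (- (y * sinh mu * s * s))
   <= K / y * exp (- (y * sinh mu / 4 * s * s)).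
Proof.
  intros hM hmu.
  pose proof (sinh_pos mu hmu) as Hs. pose proof (cosh_pos mu) as Hc.
  pose proof (half_width_bound mu hmu) as Hd.
  set (sg := sinh mu) in *. set (ch := cosh mu) in *.
  set (K0 := 2592 * ch ^ 2 / sg ^ 3 + 72 * M ^ 2 / sg + 96 / sg).
  assert (T1 : 0 <= 2592 * ch ^ 2 / sg ^ 3).
  { apply Rmult_le_pos; [nra|]. left; apply Rinv_0_lt_compat, pow_lt, Hs. }
  assert (T2 : 0 <= 72 * M ^ 2 / sg).
  { apply Rmult_le_pos; [nra|]. left; apply Rinv_0_lt_compat, Hs. }
  assert (T3 : 0 <= 96 / sg).
  { apply Rmult_le_pos; [lra|]. left; apply Rinv_0_lt_compat, Hs. }
  exists (1884 * K0 * exp (6 * M)).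
  split. { pose proof (exp_pos (6 * M)). unfold K0. nra. }
  intros r y s Hr Hy Hs'.
  destruct (saddle_taylor s) as (B1 & B2 & B3 & B4);
    [rewrite Rabs_pos_eq; lra|].
  rewrite (Rabs_pos_eq s) in * by lra.
  set (p := y * sg * s * s).
  assert (Hp : 0 <= p) by (unfold p; apply Rmult_le_pos; [apply Rmult_le_pos|]; nra).
  assert (HE : Cmod (even_rest y mu s) <= 16 * (y * sg) * s ^ 4).
  { unfold even_rest. fold sg. eapply Rle_trans; [apply Cmod_le_add|].
    rewrite !Rabs_mult, Rabs_Ropp, (Rabs_pos_eq y), (Rabs_pos_eq sg) by lra.
    assert (0 <= y * sg) by nra. nra. }
  assert (HO : Cmod (odd_rest r y mu s) <= 12 * (y * ch) * s ^ 3 + 2 * M * s).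
  { unfold odd_rest. fold ch. eapply Rle_trans; [apply Cmod_le_add|].
    assert (Rabs (r * s) <= M * s).
    { rewrite Rabs_mult, (Rabs_pos_eq s) by lra. apply Rmult_le_compat_r; lra. }
    assert (0 <= y * ch) by nra.
    assert (Rabs (- y * ch * (cosh s * sin s - s)) <= y * ch * (6 * s ^ 3)).
    { rewrite !Rabs_mult, Rabs_Ropp, (Rabs_pos_eq y), (Rabs_pos_eq ch) by lra.
      apply Rmult_le_compat_l; lra. }
    assert (Rabs (- y * ch * (sinh s * cos s - s)) <= y * ch * (6 * s ^ 3)).
    { rewrite !Rabs_mult, Rabs_Ropp, (Rabs_pos_eq y), (Rabs_pos_eq ch) by lra.
      apply Rmult_le_compat_l; lra. }
    pose proof (Rabs_triang (- y * ch * (cosh s * sin s - s)) (r * s)).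
    pose proof (Rabs_triang (- y * ch * (sinh s * cos s - s)) (- (r * s))) as T.
    rewrite Rabs_Ropp in T. unfold Rminus in *. lra. }
  set (E := Cmod (even_rest y mu s)) in *. set (O := Cmod (odd_rest r y mu s)) in *.
  assert (E0 : 0 <= E) by apply Cmod_ge_0. assert (O0 : 0 <= O) by apply Cmod_ge_0.
  assert (Hwid : ch * s <= sg / 100).
  { apply Rle_trans with (ch * half_width mu); [apply Rmult_le_compat_l; lra|].
    unfold half_width. fold sg ch. right. field. lra. }
  assert (HEO : E + 3 * O <= p / 2 + 6 * M).
  { assert (y * ch * s ^ 3 <= p / 100).
    { replace (y * ch * s ^ 3) with (y * s ^ 2 * (ch * s)) by ring.
      replace (p / 100) with (y * s ^ 2 * (sg / 100)) by (unfold p; field).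
      apply Rmult_le_compat_l; [nra|exact Hwid]. }
    assert (y * sg * s ^ 4 <= p / 10000).
    { replace (y * sg * s ^ 4) with (p * (s * s)) by (unfold p; ring).
      unfold Rdiv. apply Rmult_le_compat_l; [exact Hp|]. nra. }
    assert (M * s <= M) by nra. lra. }
  assert (HP : 9 * O ^ 2 + 6 * E <= K0 / y * (p + p ^ 2 + p ^ 3)).
  { assert (O ^ 2 <= (12 * (y * ch) * s ^ 3 + 2 * M * s) ^ 2)
      by (apply pow_incr; lra).
    assert (O ^ 2 <= 2 * (12 * (y * ch) * s ^ 3) ^ 2 + 2 * (2 * M * s) ^ 2).
    { pose proof (pow2_ge_0 (12 * (y * ch) * s ^ 3 - 2 * M * s)). lra. }
    apply Rle_trans with (2592 * ch ^ 2 / sg ^ 3 * (p ^ 3 / y)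
       + 72 * M ^ 2 / sg * (p / y) + 96 / sg * (p ^ 2 / y)).
    - replace (2592 * ch ^ 2 / sg ^ 3 * (p ^ 3 / y)) with
        (9 * (2 * (12 * (y * ch) * s ^ 3) ^ 2)) by (unfold p; field; lra).
      replace (72 * M ^ 2 / sg * (p / y)) with (9 * (2 * (2 * M * s) ^ 2))
        by (unfold p; field; lra).
      replace (96 / sg * (p ^ 2 / y)) with (6 * (16 * (y * sg) * s ^ 4))
        by (unfold p; field; lra).
      lra.
    - replace (K0 / y * (p + p ^ 2 + p ^ 3)) with
        (K0 * (p / y) + K0 * (p ^ 2 / y) + K0 * (p ^ 3 / y)) by (field; lra).
      assert (0 <= p / y) by (apply Rdiv_le_0_compat; lra).
      assert (0 <= p ^ 2 / y) by (apply Rdiv_le_0_compat; [apply pow_le|]; lra).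
      assert (0 <= p ^ 3 / y) by (apply Rdiv_le_0_compat; [apply pow_le|]; lra).
      assert (2592 * ch ^ 2 / sg ^ 3 <= K0) by (unfold K0; lra).
      assert (72 * M ^ 2 / sg <= K0) by (unfold K0; lra).
      assert (96 / sg <= K0) by (unfold K0; lra).
      pose proof (Rmult_le_compat_r (p ^ 3 / y) _ _ ltac:(assumption)
        (ltac:(assumption) : 2592 * ch ^ 2 / sg ^ 3 <= K0)).
      pose proof (Rmult_le_compat_r (p / y) _ _ ltac:(assumption)
        (ltac:(assumption) : 72 * M ^ 2 / sg <= K0)).
      pose proof (Rmult_le_compat_r (p ^ 2 / y) _ _ ltac:(assumption)
        (ltac:(assumption) : 96 / sg <= K0)).
      lra. }
  assert (HK0 : 0 <= K0 / y) by (apply Rdiv_le_0_compat; unfold K0; lra).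
  apply Rle_trans with
    (K0 / y * (1884 * exp (p / 4)) * exp (p / 2 + 6 * M) * exp (- p)).
  - apply Rmult_le_compat_r; [left; apply exp_pos|].
    eapply Rle_trans; [apply Cexp_sym_le|]. fold E O.
    apply Rmult_le_compat; [nra | left; apply exp_pos | | now apply exp_le_compat].
    eapply Rle_trans; [exact HP|].
    apply Rmult_le_compat_l; [exact HK0 | now apply poly_le_exp].
  - right. replace (- (y * sg / 4 * s * s)) with (p / 4 + (p / 2 + - p))
      by (unfold p; field).
    rewrite !exp_plus. field. lra.
Qed.

Lemma is_RInt_C_scal (c : C) (f : R -> R) (a b l : R) :
  is_RInt f a b l ->
  is_RInt (V := C_R_NormedModule) (fun s => c * RtoC (f s))%C a b (c * RtoC l)%C.
Proof.
  intros H. destruct c as [c d].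
  replace ((c, d) * RtoC l)%C with ((c * l, d * l) : C)
    by (apply injective_projections; simpl; ring).
  apply (is_RInt_fct_extend_pair (U := R_NormedModule) (V := R_NormedModule)).
  - apply is_RInt_ext with (f := fun s => scal c (f s)).
    + intros s _. unfold scal; simpl; unfold mult; simpl. ring.
    + exact (is_RInt_scal (V := R_NormedModule) f a b c l H).
  - apply is_RInt_ext with (f := fun s => scal d (f s)).
    + intros s _. unfold scal; simpl; unfold mult; simpl. ring.
    + exact (is_RInt_scal (V := R_NormedModule) f a b d l H).
Qed.

(** From [exp x >= (1 + x / 2)^2] and [sqrt y <= y]. *)
Lemma exp_neg_le (c : R) : 0 < c ->
  forall y, 1 <= y -> exp (- (c * y)) <= 4 / c ^ 2 / (y * sqrt y).
Proof.
  intros Hc y Hy.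
  assert (Hs : 1 <= sqrt y) by (rewrite <- sqrt_1; apply sqrt_le_1; lra).
  pose proof (sqrt_sqrt y ltac:(lra)) as E.
  assert (Hx : 0 < c * y) by nra.
  assert (Q : (c * y) ^ 2 / 4 <= exp (c * y)).
  { pose proof (exp_ineq1_le (c * y / 2)) as H.
    replace (exp (c * y)) with (exp (c * y / 2) * exp (c * y / 2))
      by (rewrite <- exp_plus; f_equal; field).
    nra. }
  rewrite exp_Ropp.
  replace (4 / c ^ 2 / (y * sqrt y)) with (/ ((c * c * (y * sqrt y)) / 4))
    by (field; lra).
  apply Rinv_le_contravar.
  - assert (0 < c * c * (y * sqrt y)); [|lra]. apply Rmult_lt_0_compat; nra.
  - eapply Rle_trans; [|exact Q].
    replace ((c * y) ^ 2) with (c * c * (y * y)) by ring.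
    assert (y * sqrt y <= y * y) by (apply Rmult_le_compat_l; nra).
    assert (0 < c * c) by nra. nra.
Qed.

Lemma Cexp_RtoC (x : R) : Cexp (RtoC x) = RtoC (exp x).
Proof.
  rewrite Cexp_pair; simpl. rewrite cos_0, sin_0.
  apply injective_projections; simpl; ring.
Qed.

Lemma kernel_saddle (r y mu s : R) :
  kernel r y (y * cosh mu) (saddle mu + RtoC s * (1, -1))%C
  = (kernel r y (y * cosh mu) (saddle mu) * RtoC (exp (- (y * sinh mu * s * s)))
     * Cexp (even_rest y mu s + odd_rest r y mu s))%C.
Proof.
  unfold kernel. rewrite phase_saddle, <- Cexp_RtoC, <- !Cexp_plus. reflexivity.
Qed.

Lemma kernel_saddle_opp (r y mu s : R) :
  kernel r y (y * cosh mu) (saddle mu + RtoC s * - (1, -1))%C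
  = (kernel r y (y * cosh mu) (saddle mu) * RtoC (exp (- (y * sinh mu * s * s)))
     * Cexp (even_rest y mu s - odd_rest r y mu s))%C.
Proof.
  unfold kernel. rewrite phase_saddle_opp, <- Cexp_RtoC, <- !Cexp_plus. reflexivity.
Qed.

(** Halves of the segment on both sides of the saddle are added, so that the
    integrand at [s] is the Gaussian times the symmetric sum estimated in
    [saddle_pointwise].  Extending the Gaussian integral to the whole line
    costs an exponentially small term. *)
Lemma saddle_segment (M mu : R) : 0 <= M -> 0 < mu ->
  exists K, 0 <= K /\ forall r y, Rabs r <= M -> 1 <= y ->
  let t := y * cosh mu in
  let d := half_width mu in
  Cmod (kernel_primitive r y t (saddle mu + RtoC d * (1, -1))
        - kernel_primitive r y t (saddle mu + RtoC d * - (1, -1))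
        - (1, -1) * kernel r y t (saddle mu) * RtoC (sqrt (PI / (y * sinh mu))))%C
  <= Cmod (kernel r y t (saddle mu)) * (K / (y * sqrt y)).
Proof.
  intros hM hmu.
  destruct (saddle_pointwise M mu hM hmu) as (K1 & K10 & HK1).
  pose proof (sinh_pos mu hmu) as Hs. pose proof (half_width_bound mu hmu) as Hd.
  set (sg := sinh mu) in *. set (d := half_width mu) in *.
  set (c := sg * d * d). assert (Hc : 0 < c).
  { unfold c. apply Rmult_lt_0_compat; [apply Rmult_lt_0_compat|]; lra. }
  exists (2 * (K1 * sqrt (PI / (sg / 4))) + 8 * (4 / c ^ 2 / sqrt sg)).
  assert (Hss : 0 < sqrt sg) by now apply sqrt_lt_R0.
  split.
  { pose proof (Rmult_le_pos _ _ K10 (sqrt_pos (PI / (sg / 4)))).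
    assert (0 <= 4 / c ^ 2 / sqrt sg).
    { apply Rdiv_le_0_compat; [|lra]. apply Rdiv_le_0_compat; [lra|]. now apply pow_lt. }
    lra. }
  intros r y Hr Hy t d'. fold d in d'. unfold d'. clear d'.
  set (u0 := saddle mu). set (w := (1, -1) : C). set (C0 := kernel r y t u0).
  assert (Hys : 0 < y * sg) by nra.
  destruct (gauss_scaled (y * sg) d Hys ltac:(lra)) as (I & HI & _ & HI2).
  destruct (gauss_scaled (y * sg / 4) d ltac:(lra) ltac:(lra)) as (I4 & HI4 & HI4b & _).
  assert (Hw : Cmod w <= 2).
  { eapply Rle_trans; [apply Cmod_le_add|]. rewrite Rabs_R1, Rabs_left by lra. lra. }
  pose proof (is_RInt_kernel r y t u0 w 0 d) as A1.
  pose proof (is_RInt_kernel r y t u0 (- w)%C 0 d) as A2.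
  pose proof (is_RInt_C_scal (w * C0 * 2)%C _ _ _ _ HI) as A3.
  pose proof (is_RInt_minus _ _ _ _ _ _ (is_RInt_minus _ _ _ _ _ _ A1 A2) A3) as A.
  assert (BB : Cmod (kernel_primitive r y t (u0 + RtoC d * w)
      - kernel_primitive r y t (u0 + RtoC d * - w) - w * C0 * 2 * RtoC I)%C
      <= Cmod w * Cmod C0 * (K1 / y) * I4).
  { rewrite <- norm_Cmod.
    match type of A with is_RInt _ _ _ ?l => replace (_ - _ - _)%C with l end.
    2:{ replace (u0 + RtoC 0 * w)%C with u0 by ring.
        replace (u0 + RtoC 0 * - w)%C with u0 by ring.
        apply injective_projections; simpl; unfold minus, plus, opp; simpl;
        unfold plus, opp; simpl; ring. }
    refine (norm_RInt_le (V := C_R_NormedModule) _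
      (fun s => Cmod w * Cmod C0 * (K1 / y) * exp (- (y * sg / 4 * s * s)))
      0 d _ _ _ _ A _).
    - lra.
    - intros s Hs'. rewrite norm_Cmod.
      set (e := even_rest y mu s). set (o := odd_rest r y mu s).
      set (g := exp (- (y * sg * s * s))).
      replace (minus _ _) with
        (w * C0 * RtoC g * (Cexp (e + o) + Cexp (e - o) - 2))%C.
      2:{ change minus with Cminus. cbv beta. unfold t, u0, w.
          rewrite kernel_saddle, kernel_saddle_opp.
          fold sg g w e o t u0 C0. ring. }
      rewrite !Cmod_mult, Cmod_R, (Rabs_pos_eq g) by (left; apply exp_pos).
      pose proof (HK1 r y s Hr ltac:(lra) Hs') as P. fold e o g in P.
      rewrite !(Rmult_assoc (Cmod w * Cmod C0)), (Rmult_comm g).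
      apply Rmult_le_compat_l; [|exact P].
      apply Rmult_le_pos; apply Cmod_ge_0.
    - apply (is_RInt_scal (V := R_NormedModule)). exact HI4. }
  set (X := kernel_primitive r y t (u0 + RtoC d * w)) in *.
  set (Y := kernel_primitive r y t (u0 + RtoC d * - w)) in *.
  set (q := sqrt (PI / (y * sg))) in *.
  replace (X - Y - w * C0 * RtoC q)%C with
    ((X - Y - w * C0 * 2 * RtoC I) + w * C0 * RtoC (2 * (I - q / 2)))%C.
  2:{ rewrite RtoC_mult, RtoC_minus, RtoC_div by lra. field. }
  assert (Hsy : 1 <= sqrt y) by (rewrite <- sqrt_1; apply sqrt_le_1; lra).
  pose proof (Cmod_ge_0 C0) as HC0. pose proof (Cmod_ge_0 w) as Hw0.
  assert (HI4' : I4 <= sqrt (PI / (sg / 4)) / sqrt y).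
  { eapply Rle_trans; [apply HI4b|].
    pose proof PI_RGT_0.
    replace (PI / (y * sg / 4)) with (PI / (sg / 4) / y) by (field; lra).
    rewrite sqrt_div_alt by lra.
    assert (0 <= sqrt (PI / (sg / 4)) / sqrt y).
    { apply Rdiv_le_0_compat; [apply sqrt_pos | lra]. }
    lra. }
  assert (HI' : Rabs (2 * (I - q / 2)) <= 4 * (4 / c ^ 2 / sqrt sg) / (y * sqrt y)).
  { rewrite Rabs_mult, (Rabs_pos_eq 2) by lra.
    pose proof (exp_neg_le c Hc y Hy) as He.
    replace (- (y * sg * d * d)) with (- (c * y)) in HI2 by (unfold c; ring).
    rewrite sqrt_mult in HI2 by lra.
    assert (exp (- (c * y)) / (sqrt y * sqrt sg) <= 4 / c ^ 2 / (y * sqrt y) / sqrt sg).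
    { apply Rle_trans with (exp (- (c * y)) / sqrt sg).
      - unfold Rdiv. apply Rmult_le_compat_l; [left; apply exp_pos|].
        apply Rinv_le_contravar; nra.
      - unfold Rdiv at 1 4. apply Rmult_le_compat_r; [|exact He].
        left; now apply Rinv_0_lt_compat. }
    replace (4 * (4 / c ^ 2 / sqrt sg) / (y * sqrt y)) with
      (4 * (4 / c ^ 2 / (y * sqrt y) / sqrt sg)) by (field; repeat split; nra).
    unfold Rdiv in *. lra. }
  eapply Rle_trans; [apply Cmod_triangle|].
  rewrite !Cmod_mult, Cmod_R.
  apply Rle_trans with (Cmod w * Cmod C0 * (K1 / y) * (sqrt (PI / (sg / 4)) / sqrt y)
    + Cmod w * Cmod C0 * (4 * (4 / c ^ 2 / sqrt sg) / (y * sqrt y))).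
  - apply Rplus_le_compat.
    + eapply Rle_trans; [exact BB|]. apply Rmult_le_compat_l; [|exact HI4'].
      apply Rmult_le_pos; [nra|]. apply Rdiv_le_0_compat; lra.
    + apply Rmult_le_compat_l; [nra|exact HI'].
  - replace (Cmod w * Cmod C0 * (K1 / y) * (sqrt (PI / (sg / 4)) / sqrt y)
      + Cmod w * Cmod C0 * (4 * (4 / c ^ 2 / sqrt sg) / (y * sqrt y)))
      with (Cmod w * (Cmod C0 * ((K1 * sqrt (PI / (sg / 4)) + 4 * (4 / c ^ 2 / sqrt sg))
         / (y * sqrt y)))) by (field; repeat split; nra).
    replace (Cmod C0 * ((2 * (K1 * sqrt (PI / (sg / 4))) + 8 * (4 / c ^ 2 / sqrt sg))
         / (y * sqrt y))) with (2 * (Cmod C0 * ((K1 * sqrt (PI / (sg / 4))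
         + 4 * (4 / c ^ 2 / sqrt sg)) / (y * sqrt y)))) by (field; repeat split; nra).
    apply Rmult_le_compat_r; [|exact Hw].
    apply Rmult_le_pos; [exact HC0|]. apply Rdiv_le_0_compat; [|nra].
    pose proof (Rmult_le_pos _ _ K10 (sqrt_pos (PI / (sg / 4)))).
    assert (0 <= 4 / c ^ 2 / sqrt sg).
    { apply Rdiv_le_0_compat; [|lra]. apply Rdiv_le_0_compat; [lra|]. now apply pow_lt. }
    lra.
Qed.

(** * The rest of the contour *)

Lemma cosh_ge_1 x : 1 <= cosh x.
Proof.
  unfold cosh. pose proof (exp_ineq1_le x). pose proof (exp_ineq1_le (- x)). lra.
Qed.

Lemma sinh_ge_id x : 0 <= x -> x <= sinh x.
Proof.
  intros Hx. destruct (MVT_gen sinh 0 x cosh) as [c [_ E]].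
  - intros u _. auto_derive; auto; ring.
  - intros u _. apply derivable_continuous_pt, derivable_pt_sinh.
  - rewrite sinh_0 in E. pose proof (cosh_ge_1 c). nra.
Qed.

Lemma cosh_ge_tangent b x : 0 <= b <= x -> cosh b + sinh b * (x - b) <= cosh x.
Proof.
  intros H. replace x with (b + (x - b)) at 2 by ring. rewrite cosh_plus.
  pose proof (cosh_ge_1 (x - b)). pose proof (cosh_ge_1 b).
  pose proof (sinh_ge_id (x - b) ltac:(lra)). pose proof (sinh_ge_id b ltac:(lra)). nra.
Qed.

Lemma cosh_mono a b : 0 <= a <= b -> cosh a <= cosh b.
Proof.
  intros H. pose proof (cosh_ge_tangent a b H). pose proof (sinh_ge_id a ltac:(lra)). nra.
Qed.

Lemma half_width_lt mu : 0 < mu -> half_width mu < mu.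
Proof.
  intros H. pose proof (cosh_ge_1 mu). pose proof (sinh_pos mu H).
  assert (sinh mu <= cosh mu * mu).
  { rewrite <- (Rabs_pos_eq mu) at 3 by lra.
    replace (sinh mu) with (sinh mu - sinh 0) by (rewrite sinh_0; ring).
    eapply Rle_trans; [apply Rle_abs|]. apply (increment_le sinh cosh).
    - intros u _. auto_derive; auto; ring.
    - intros u Hu. rewrite Rabs_pos_eq by (pose proof (cosh_ge_1 u); lra).
      rewrite (Rabs_pos_eq mu) in Hu by lra.
      apply Rle_trans with (cosh (Rabs u)).
      + unfold Rabs. destruct (Rcase_abs u); [rewrite cosh_opp|]; lra.
      + apply cosh_mono. split; [apply Rabs_pos|exact Hu]. }
  unfold half_width. apply Rlt_div_l; [lra|]. nra.
Qed.

(** Up to the factor [y], these are the amounts by which the real part of the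
    exponent (apart from [r z]) drops from the saddle to the two ends of the
    sloped segment.  They agree with [sinh mu d^2] to leading order in [d]. *)
Lemma contour_gaps mu : 0 < mu ->
  let d := half_width mu in
  0 < cosh (mu + d) * sin d - cosh mu * d /\
  0 < cosh mu * d - cosh (mu - d) * sin d.
Proof.
  intros Hmu d. pose proof (half_width_bound mu Hmu) as Hd. fold d in Hd.
  pose proof (sinh_pos mu Hmu) as Hs. pose proof (cosh_ge_1 mu) as Hc.
  assert (Hcd : cosh mu * d = sinh mu / 100) by (unfold d, half_width; field; lra).
  destruct (saddle_taylor d) as (_ & B2 & B3 & _); [rewrite Rabs_pos_eq; lra|].
  rewrite (Rabs_pos_eq d) in * by lra.
  apply Rabs_le_between in B2. apply Rabs_le_between in B3.
  replace (mu - d) with (mu + - d) by ring.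
  rewrite !cosh_plus, cosh_opp, sinh_opp.
  set (sg := sinh mu) in *. set (ch := cosh mu) in *.
  assert (G : 0 < sg * (d ^ 2 - 12 * d ^ 4) - ch * (6 * d ^ 3)).
  { replace (sg * (d ^ 2 - 12 * d ^ 4) - ch * (6 * d ^ 3)) with
      (d ^ 2 * (sg * (1 - 12 * d ^ 2) - 6 * (ch * d))) by ring.
    rewrite Hcd. apply Rmult_lt_0_compat; [nra|].
    assert (d ^ 2 <= / 100) by nra. nra. }
  assert (sg * (d ^ 2 - 12 * d ^ 4) <= sg * (sinh d * sin d))
    by (apply Rmult_le_compat_l; lra).
  assert (ch * (d - 6 * d ^ 3) <= ch * (cosh d * sin d))
    by (apply Rmult_le_compat_l; lra).
  assert (ch * (cosh d * sin d) <= ch * (d + 6 * d ^ 3))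
    by (apply Rmult_le_compat_l; lra).
  split; lra.
Qed.

Definition tends_to (F : R -> C) (l : C) : Prop :=
  forall eps, 0 < eps -> exists A, forall x, A < x -> Cmod (F x - l)%C < eps.

Lemma exp_neg_small (K eps : R) : 0 <= K -> 0 < eps ->
  exists A, 0 <= A /\ forall x, A < x -> K * exp (- x) < eps.
Proof.
  intros HK He. exists (K / eps). split; [apply Rdiv_le_0_compat; lra|].
  intros x Hx. rewrite exp_Ropp.
  assert (0 <= K / eps) by (apply Rdiv_le_0_compat; lra).
  pose proof (exp_ineq1_le x). apply Rlt_div_l; [apply exp_pos|].
  apply Rlt_div_l in Hx; [|lra]. nra.
Qed.

Lemma exp_cauchy_limit (F : R -> C) (b K : R) : 0 <= K ->
  (forall u v, b <= u <= v -> Cmod (F v - F u)%C <= K * exp (- u)) ->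
  exists l, tends_to F l /\ Cmod (l - F b)%C <= K * exp (- b).
Proof.
  intros HK HF.
  destruct (proj1 (filterlim_locally_cauchy (U := C_R_CompleteNormedModule)
     (F := Rbar_locally p_infty) F)) as [l Hl].
  { intros eps. destruct (exp_neg_small K eps HK (cond_pos eps)) as [A [_ HA]].
    exists (fun x => Rmax A b < x). split; [now exists (Rmax A b)|].
    assert (S : forall u v, Rmax A b < u -> u <= v -> Cmod (F v - F u)%C < eps).
    { intros u v Hu Hv. pose proof (Rmax_l A b). pose proof (Rmax_r A b).
      eapply Rle_lt_trans; [apply HF; lra|]. apply HA; lra. }
    intros u v Hu Hv.
    apply (norm_compat1 (V := C_R_NormedModule)). rewrite norm_Cmod.
    change (Cmod (F v - F u)%C < eps).
    destruct (Rle_dec u v).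
    - now apply S.
    - replace (F v - F u)%C with (- (F u - F v))%C by ring. rewrite Cmod_opp.
      apply S; lra. }
  assert (T : tends_to F l).
  { intros eps He.
    assert (He2 : 0 < eps / 2) by lra.
    destruct (proj1 (filterlim_locally _ _) Hl (mkposreal _ He2)) as [A HA].
    exists A. intros x Hx. destruct (HA x Hx) as [H1 H2]. simpl in H1, H2.
    eapply Rle_lt_trans;
      [exact (Cmod_le_add (fst (F x) + - fst l) (snd (F x) + - snd l))|].
    change (Rabs (fst (F x) + - fst l) < eps / 2) in H1.
    change (Rabs (snd (F x) + - snd l) < eps / 2) in H2.
    lra. }
  exists l. split; [exact T|].
  apply Rle_plus_epsilon. intros e He.
  destruct (T e He) as [A HA].
  set (x := Rmax A b + 1). pose proof (Rmax_l A b). pose proof (Rmax_r A b).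
  specialize (HA x ltac:(unfold x; lra)).
  pose proof (HF b x ltac:(unfold x; lra)).
  replace (l - F b)%C with (- (F x - l) + (F x - F b))%C by ring.
  eapply Rle_trans; [apply Cmod_triangle|]. rewrite Cmod_opp. lra.
Qed.

Lemma Cmod_kernel (r y t : R) (z : C) : Cmod (kernel r y t z) = exp (Re (phase r y t z)).
Proof. apply Cmod_Cexp. Qed.

Lemma horizontal_increment_le (r y t h u v B : R) : u <= v ->
  (forall x, u <= x <= v -> Re (phase r y t (x, h)) <= B) ->
  Cmod (kernel_primitive r y t (v, h) - kernel_primitive r y t (u, h))%C
    <= (v - u) * exp B.
Proof.
  intros Huv HB.
  pose proof (is_RInt_kernel r y t (0, h) 1 u v) as H.
  assert (L : forall x, ((0, h) + RtoC x * 1)%C = (x, h))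
    by (intros x; apply injective_projections; simpl; ring).
  rewrite !L in H. rewrite <- norm_Cmod.
  apply (norm_RInt_le_const (V := C_R_NormedModule)) with (3 := H); [exact Huv|].
  intros x Hx. rewrite norm_Cmod, L, Cmult_1_l, Cmod_kernel.
  now apply exp_le_compat, HB.
Qed.

Lemma horizontal_tail_le (r y t h u v B : R) : u <= v ->
  (forall x, u <= x <= v -> Re (phase r y t (x, h)) <= B - x) ->
  Cmod (kernel_primitive r y t (v, h) - kernel_primitive r y t (u, h))%C
    <= exp B * exp (- u).
Proof.
  intros Huv HB.
  pose proof (is_RInt_kernel r y t (0, h) 1 u v) as H.
  assert (L : forall x, ((0, h) + RtoC x * 1)%C = (x, h))
    by (intros x; apply injective_projections; simpl; ring).
  rewrite !L in H. rewrite <- norm_Cmod.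
  assert (G : is_RInt (fun x => exp (B - x)) u v (exp (B - u) - exp (B - v))).
  { replace (exp (B - u) - exp (B - v)) with (minus (- exp (B - v)) (- exp (B - u)))
      by (unfold minus, plus, opp; simpl; ring).
    apply (is_RInt_derive (V := R_CompleteNormedModule) (fun x => - exp (B - x))).
    - intros x _. auto_derive; auto; unfold Rminus; ring.
    - intros x _. apply (ex_derive_continuous (V := R_NormedModule)). auto_derive; auto. }
  eapply Rle_trans.
  - refine (norm_RInt_le (V := C_R_NormedModule) _ _ u v _ _ Huv _ H G).
    intros x Hx. rewrite norm_Cmod, L, Cmult_1_l, Cmod_kernel.
    now apply exp_le_compat, HB.
  - rewrite <- exp_plus. pose proof (exp_pos (B - v)). unfold Rminus in *. lra.
Qed.

Lemma vertical_increment_le (r y t x h B : R) : 0 <= h ->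
  (forall u, 0 <= u <= h -> Re (phase r y t (x, u)) <= B) ->
  Cmod (kernel_primitive r y t (x, h) - kernel_primitive r y t (x, 0))%C <= h * exp B.
Proof.
  intros Hh HB.
  pose proof (is_RInt_kernel r y t (x, 0) Ci 0 h) as H.
  assert (L : forall u, ((x, 0) + RtoC u * Ci)%C = (x, u))
    by (intros u; apply injective_projections; simpl; ring).
  rewrite !L in H. rewrite <- norm_Cmod.
  replace (h * exp B) with ((h - 0) * exp B) by ring.
  apply (norm_RInt_le_const (V := C_R_NormedModule)) with (3 := H); [exact Hh|].
  intros u Hu. rewrite norm_Cmod, L, Cmod_mult, Cmod_Ci, Rmult_1_l, Cmod_kernel.
  now apply exp_le_compat, HB.
Qed.

Lemma Rmult_le_of_Rabs r M x : Rabs r <= M -> 0 <= x -> r * x <= M * x.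
Proof.
  intros Hr Hx. apply Rmult_le_compat_r; [exact Hx|].
  eapply Rle_trans; [apply Rle_abs|exact Hr].
Qed.

(** The integral over the positive half line is [L] minus the value of the
    primitive at 0.  Here [L] is reached along the contour that starts at
    [i (PI / 2 + d)]; the real axis has the same limit because the vertical
    segment between the two lines at abscissa [x] contributes [O(exp (- x))]. *)
Lemma half_line_asymptotics (M mu : R) : 0 <= M -> 0 < mu ->
  exists K Y, 1 <= Y /\ 0 <= K /\ forall r y, Rabs r <= M -> Y <= y ->
  let t := y * cosh mu in
  exists L, tends_to (fun x => kernel_primitive r y t (RtoC x)) L /\
   Cmod (L - kernel_primitive r y t (0, PI / 2 + half_width mu)%R
      - (1, -1) * kernel r y t (saddle mu) * RtoC (sqrt (PI / (y * sinh mu))))%C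
   <= K / (y * sqrt y) * exp (- y * (PI / 2) * cosh mu).
Proof.
  intros hM hmu.
  destruct (saddle_segment M mu hM hmu) as (K1 & HK1 & Hseg).
  pose proof (sinh_pos mu hmu) as Hs. pose proof (half_width_bound mu hmu) as Hd.
  pose proof (half_width_lt mu hmu) as Hd'.
  pose proof (contour_gaps mu hmu) as [G0 G1]. 
  set (d := half_width mu) in *.
  set (c0 := cosh (mu + d) * sin d - cosh mu * d) in *.
  set (c1 := cosh mu * d - cosh (mu - d) * sin d) in *.
  pose proof PI2_1 as HPI. pose proof (cosh_ge_1 mu) as Hch.
  assert (Hsd : 0 < sin d) by (apply sin_gt_0; lra).
  set (b := mu + d). set (m := sin d * Rmin 1 (sinh b)).
  assert (Hsb : 0 < sinh b) by (apply sinh_pos; unfold b; lra).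
  assert (Hm : 0 < m) by (apply Rmult_lt_0_compat; [|apply Rmin_pos]; lra).
  (* contributions of the saddle, of the tail and of the left segment; [Y] makes
     the decay of the tail beat the factor [exp (r x)] *)
  exists (exp (M * mu) * K1 + exp (M * b) * (4 / c0 ^ 2)
          + mu * exp (M * mu) * (4 / c1 ^ 2)), (Rmax 1 ((M + 1) / m)).
  assert (P0 : 0 < 4 / c0 ^ 2) by (apply Rdiv_lt_0_compat; [lra|now apply pow_lt]).
  assert (P1 : 0 < 4 / c1 ^ 2) by (apply Rdiv_lt_0_compat; [lra|now apply pow_lt]).
  split; [apply Rmax_l|]. split.
  { pose proof (exp_pos (M * mu)). pose proof (exp_pos (M * b)).
    assert (0 <= mu * exp (M * mu)) by nra. nra. }
  intros r y Hr HY t.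
  assert (Hy : 1 <= y) by (eapply Rle_trans; [apply Rmax_l | exact HY]).
  assert (HyM : M + 1 <= y * m).
  { apply Rle_div_l; [exact Hm|]. eapply Rle_trans; [apply Rmax_r | exact HY]. }
  assert (Hy1 : M + 1 <= y * sin d).
  { eapply Rle_trans; [exact HyM|]. apply Rmult_le_compat_l; [lra|]. unfold m.
    rewrite <- (Rmult_1_r (sin d)) at 2. apply Rmult_le_compat_l; [lra|]. apply Rmin_l. }
  assert (Hyb : M + 1 <= y * sin d * sinh b).
  { eapply Rle_trans; [exact HyM|]. rewrite Rmult_assoc.
    apply Rmult_le_compat_l; [lra|]. unfold m.
    apply Rmult_le_compat_l; [lra|]. apply Rmin_r. }
  set (e := - y * (PI / 2) * cosh mu).
  set (Phi := kernel_primitive r y t).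
  assert (Htail : forall x, b <= x ->
     Re (phase r y t (x, PI / 2 - d)%R) <= e - y * c0 + M * b + b - x).
  { intros x Hx. unfold phase; simpl. rewrite cos_shift.
    pose proof (cosh_ge_tangent b x ltac:(unfold b in *; lra)) as T.
    pose proof (Rmult_le_of_Rabs r M x Hr ltac:(unfold b in *; lra)).
    assert (y * sin d * (cosh b + sinh b * (x - b)) <= y * sin d * cosh x)
      by (apply Rmult_le_compat_l; [nra|exact T]).
    assert ((M + 1) * (x - b) <= y * sin d * sinh b * (x - b))
      by (apply Rmult_le_compat_r; lra).
    unfold e, c0, t. fold b. lra. }
  destruct (exp_cauchy_limit (fun x => Phi (x, PI / 2 - d)%R) b
     (exp (e - y * c0 + M * b + b))) as (L & HL & HLb).
  { left; apply exp_pos. }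
  { intros u v Huv. apply horizontal_tail_le; [lra|].
    intros x Hx. apply Htail. lra. }
  exists L. split.
  { intros eps He.
    destruct (HL (eps / 2) ltac:(lra)) as [A1 HA1].
    destruct (exp_neg_small (PI / 2) (eps / 2)) as [A2 [HA20 HA2]]; [lra..|].
    exists (Rmax A1 A2). intros x Hx.
    pose proof (Rmax_l A1 A2). pose proof (Rmax_r A1 A2).
    specialize (HA1 x ltac:(lra)). specialize (HA2 x ltac:(lra)).
    replace (Phi (RtoC x) - L)%C with
      ((Phi (x, PI / 2 - d)%R - L) - (Phi (x, PI / 2 - d)%R - Phi (RtoC x)))%C by ring.
    assert (V : Cmod (Phi (x, PI / 2 - d)%R - Phi (RtoC x))%C
                 <= (PI / 2 - d) * exp (- x)).
    { apply vertical_increment_le; [lra|]. intros u Hu.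
      unfold phase; simpl.
      pose proof (sinh_ge_id x ltac:(lra)). pose proof (sinh_lt_cosh x).
      pose proof (Rmult_le_of_Rabs r M x Hr ltac:(lra)).
      assert (sin d <= cos u).
      { rewrite <- cos_shift. apply cos_decr_1; lra. }
      assert (0 <= t * u) by (unfold t; apply Rmult_le_pos; [nra|lra]).
      assert (y * sin d * x <= y * cosh x * cos u).
      { replace (y * cosh x * cos u) with (y * cos u * cosh x) by ring.
        assert (y * sin d <= y * cos u) by (apply Rmult_le_compat_l; lra).
        apply Rmult_le_compat; lra. }
      assert ((M + 1) * x <= y * sin d * x) by (apply Rmult_le_compat_r; lra).
      lra. }
    unfold Cminus at 1.
    eapply Rle_lt_trans; [apply Cmod_triangle|]. rewrite Cmod_opp.
    assert ((PI / 2 - d) * exp (- x) <= PI / 2 * exp (- x)).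
    { apply Rmult_le_compat_r; [left; apply exp_pos|lra]. }
    lra. }
  assert (Hleft : Cmod (Phi (mu - d, PI / 2 + d)%R - Phi (0, PI / 2 + d)%R)%C
     <= (mu - d - 0) * exp (e - y * c1 + M * mu)).
  { apply horizontal_increment_le; [lra|]. intros x Hx.
    unfold phase; simpl. replace (PI / 2 + d) with (PI / 2 - - d) at 1 by ring.
    rewrite cos_shift, sin_neg.
    pose proof (Rmult_le_of_Rabs r M x Hr ltac:(lra)).
    assert (M * x <= M * mu) by (apply Rmult_le_compat_l; lra).
    assert (y * sin d * cosh x <= y * sin d * cosh (mu - d))
      by (apply Rmult_le_compat_l; [nra|apply cosh_mono; lra]).
    unfold e, c1, t. lra. }
  specialize (Hseg r y Hr Hy). cbv zeta in Hseg. fold d t in Hseg. fold Phi in Hseg.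
  replace (saddle mu + RtoC d * (1, -1))%C with ((b, PI / 2 - d)%R : C) in Hseg
    by (apply injective_projections; simpl; unfold b; ring).
  replace (saddle mu + RtoC d * - (1, -1))%C with ((mu - d, PI / 2 + d)%R : C) in Hseg
    by (apply injective_projections; simpl; ring).
  set (T := ((1, -1) * kernel r y t (saddle mu) * RtoC (sqrt (PI / (y * sinh mu))))%C) in *.
  replace (L - Phi (0, PI / 2 + d)%R - T)%C with
    ((L - Phi (b, PI / 2 - d)%R) + ((Phi (b, PI / 2 - d)%R - Phi (mu - d, PI / 2 + d)%R - T)
      + (Phi (mu - d, PI / 2 + d)%R - Phi (0, PI / 2 + d)%R)))%C by ring.
  assert (HC0 : Cmod (kernel r y t (saddle mu)) <= exp (M * mu) * exp e).
  { rewrite Cmod_kernel, <- exp_plus. apply exp_le_compat.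
    unfold phase, saddle; simpl. rewrite cos_PI2.
    pose proof (Rmult_le_of_Rabs r M mu Hr ltac:(lra)). unfold e, t. lra. }
  assert (Hsy : 0 < y * sqrt y) by (apply Rmult_lt_0_compat; [|apply sqrt_lt_R0]; lra).
  assert (B1 : Cmod (L - Phi (b, PI / 2 - d)%R)%C
     <= exp (M * b) * (4 / c0 ^ 2) / (y * sqrt y) * exp e).
  { eapply Rle_trans; [exact HLb|]. rewrite <- exp_plus.
    replace (e - y * c0 + M * b + b + - b) with (e + (M * b + - (c0 * y))) by ring.
    rewrite !exp_plus, Rmult_comm.
    apply Rmult_le_compat_r; [left; apply exp_pos|].
    unfold Rdiv at 1. rewrite Rmult_assoc.
    apply Rmult_le_compat_l; [left; apply exp_pos|]. now apply exp_neg_le. }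
  assert (B2 : Cmod (Phi (mu - d, PI / 2 + d)%R - Phi (0, PI / 2 + d)%R)%C
     <= mu * exp (M * mu) * (4 / c1 ^ 2) / (y * sqrt y) * exp e).
  { eapply Rle_trans; [exact Hleft|].
    replace (e - y * c1 + M * mu) with (e + (M * mu + - (c1 * y))) by ring.
    rewrite !exp_plus.
    pose proof (exp_neg_le c1 G1 y Hy) as Q.
    apply Rle_trans with (mu * (exp e * (exp (M * mu) * exp (- (c1 * y))))).
    - apply Rmult_le_compat_r; [|lra].
      left; repeat apply Rmult_lt_0_compat; apply exp_pos.
    - replace (mu * exp (M * mu) * (4 / c1 ^ 2) / (y * sqrt y) * exp e)
        with (mu * (exp e * (exp (M * mu) * (4 / c1 ^ 2 / (y * sqrt y)))))
        by (unfold Rdiv; ring).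
      apply Rmult_le_compat_l; [lra|].
      apply Rmult_le_compat_l; [left; apply exp_pos|].
      apply Rmult_le_compat_l; [left; apply exp_pos|]. exact Q. }
  assert (B3 : Cmod (Phi (b, PI / 2 - d)%R - Phi (mu - d, PI / 2 + d)%R - T)%C
     <= exp (M * mu) * K1 / (y * sqrt y) * exp e).
  { eapply Rle_trans; [exact Hseg|].
    replace (exp (M * mu) * K1 / (y * sqrt y) * exp e) with
      (exp (M * mu) * exp e * (K1 / (y * sqrt y))) by (unfold Rdiv; ring).
    apply Rmult_le_compat_r; [|exact HC0]. apply Rdiv_le_0_compat; lra. }
  eapply Rle_trans; [apply Cmod_triangle|].
  eapply Rle_trans; [apply Rplus_le_compat_l, Cmod_triangle|].
  unfold Rdiv in *. lra.
Qed.

(** * The Bessel function *)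

Open Scope C_scope.

Lemma besselK_integrand (r y t u : R) :
  Cexp (RtoC (- y * cosh u) + (RtoC r + Ci * RtoC t) * RtoC u) = kernel r y t (RtoC u).
Proof.
  unfold kernel. f_equal. unfold phase; simpl. rewrite cos_0, sin_0.
  apply injective_projections; simpl; ring.
Qed.

Lemma is_RInt_gen_C (f Psi : R -> C) (lm lp : C) :
  (forall a b, is_RInt (V := C_R_NormedModule) f a b (Psi b - Psi a)) ->
  tends_to (fun x => Psi (- x)%R) lm -> tends_to Psi lp ->
  is_RInt_gen (V := C_R_NormedModule) f (Rbar_locally m_infty) (Rbar_locally p_infty)
    (lp - lm).
Proof.
  intros Hf Hm Hp. apply filterlimi_locally. intros eps.
  pose proof (cond_pos eps) as He.
  destruct (Hm (eps / 2)%R ltac:(lra)) as [A HA].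
  destruct (Hp (eps / 2)%R ltac:(lra)) as [B HB].
  exists (fun a => (a < - A)%R) (fun b => (B < b)%R).
  - now exists (- A)%R.
  - now exists B.
  - intros a b Ha Hb. exists (Psi b - Psi a). split; [apply Hf|].
    apply (norm_compat1 (V := C_R_NormedModule)). rewrite norm_Cmod.
    change (Cmod ((Psi b - Psi a) - (lp - lm)) < eps)%R.
    specialize (HA (- a)%R ltac:(lra)). rewrite Ropp_involutive in HA.
    specialize (HB b Hb).
    replace ((Psi b - Psi a) - (lp - lm)) with ((Psi b - lp) + - (Psi a - lm)) by ring.
    eapply Rle_lt_trans; [apply Cmod_triangle|]. rewrite Cmod_opp. lra.
Qed.

(** The value of the primitive at [- x] is minus the conjugate of its value at
    [x] with [- r] for [r], hence the sign in front of the second limit. *)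
Lemma besselK_limits (r y t : R) (L L' : C) :
  tends_to (fun x => kernel_primitive r y t (RtoC x)) L ->
  tends_to (fun x => kernel_primitive (- r) y t (RtoC x)) L' ->
  besselK (RtoC r + Ci * RtoC t) y = RtoC (1 / 2) * (L + Cconj L').
Proof.
  intros HL HL'. unfold besselK. f_equal.
  apply (is_RInt_gen_unique (V := C_R_CompleteNormedModule)).
  replace (L + Cconj L') with (L - - Cconj L') by ring.
  apply (is_RInt_gen_C _ (fun x => kernel_primitive r y t (RtoC x))); [| |exact HL].
  - intros a b. pose proof (is_RInt_kernel r y t 0 1 a b) as H.
    replace (0 + RtoC a * 1) with (RtoC a) in H by ring.
    replace (0 + RtoC b * 1) with (RtoC b) in H by ring.
    apply (is_RInt_ext (V := C_R_NormedModule)) with (2 := H).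
    intros x _. rewrite besselK_integrand, Cmult_1_l. f_equal. ring.
  - intros eps He. destruct (HL' eps He) as [A HA]. exists A. intros x Hx.
    replace (RtoC (- x)) with (- Cconj (RtoC x))
      by (apply injective_projections; simpl; ring).
    rewrite kernel_primitive_reflect.
    replace (- Cconj (kernel_primitive (- r) y t (RtoC x)) - - Cconj L')
      with (- Cconj (kernel_primitive (- r) y t (RtoC x) - L'))
      by (rewrite Cminus_conj; ring).
    rewrite Cmod_opp, Cmod_conj. now apply HA.
Qed.

(** The factor [1 - i = sqrt 2 exp (- i PI / 4)], the direction of the path at
    the saddle, accounts for the shift by [PI / 4] in the sine and the cosine
    and for the factor 2 under the square root. *)
Lemma saddle_terms (r y mu : R) : (0 < mu)%R -> (0 < y)%R ->
  let t := (y * cosh mu)%R in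
  let T r := (1, -1)%R * kernel r y t (saddle mu) * RtoC (sqrt (PI / (y * sinh mu))) in
  RtoC (sqrt (2 * PI / (y * sinh mu)))
          * Cexp (RtoC (- y * (PI / 2) * cosh mu) + Ci * RtoC (r * (PI / 2)))
          * (RtoC (cosh (r * mu)
                   * sin (PI / 4 - y * (sinh mu - mu * cosh mu)))
             - Ci * RtoC (sinh (r * mu)
                   * cos (PI / 4 - y * (sinh mu - mu * cosh mu))))
  = RtoC (1 / 2) * (T r + Cconj (T (- r)%R)).
Proof.
  intros Hmu Hy t T. unfold T, kernel. rewrite !Cexp_pair.
  unfold phase, saddle; simpl. rewrite cos_PI2, sin_PI2.
  set (A := (y * (sinh mu - mu * cosh mu))%R).
  set (e := (- y * (PI / 2) * cosh mu)%R).
  set (h := (r * (PI / 2))%R).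
  set (q := sqrt (PI / (y * sinh mu))).
  assert (Hq : sqrt (2 * PI / (y * sinh mu)) = (sqrt 2 * q)%R).
  { unfold q. rewrite <- sqrt_mult_alt by lra. f_equal. unfold Rdiv. ring. }
  rewrite Hq.
  assert (H2 : (sqrt 2 * sqrt 2 = 2)%R) by (apply sqrt_sqrt; lra).
  assert (H20 : (0 < sqrt 2)%R) by (apply sqrt_lt_R0; lra).
  assert (HS : (sqrt 2 * sin (PI / 4 - A) = cos A - sin A)%R).
  { rewrite sin_minus, cos_PI4, sin_PI4. field. lra. }
  assert (HC : (sqrt 2 * cos (PI / 4 - A) = cos A + sin A)%R).
  { rewrite cos_minus, cos_PI4, sin_PI4. field. lra. }
  replace (- y * cosh mu * 0 + r * mu - t * (PI / 2))%R with (r * mu + e)%R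
    by (unfold e, t; ring).
  replace (- y * cosh mu * 0 + - r * mu - t * (PI / 2))%R with (- (r * mu) + e)%R
    by (unfold e, t; ring).
  replace (- y * sinh mu * 1 + h + t * mu)%R with (h - A)%R
    by (unfold h, A, t; ring).
  replace (- y * sinh mu * 1 + - r * (PI / 2) + t * mu)%R with (- (h + A))%R
    by (unfold h, A, t; ring).
  replace (e + (0 * h - 1 * 0))%R with e by ring.
  replace (0 + (0 * 0 + 1 * h))%R with h by ring.
  rewrite cos_neg, sin_neg, (cos_minus h A), (sin_minus h A), (cos_plus h A),
    (sin_plus h A), !exp_plus.
  unfold cosh, sinh.
  set (S := sin (PI / 4 - A)) in *. set (K := cos (PI / 4 - A)) in *.
  assert (EA : cos A = ((sqrt 2 * S + sqrt 2 * K) / 2)%R) by lra.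
  assert (EB : sin A = ((sqrt 2 * K - sqrt 2 * S) / 2)%R) by lra.
  rewrite EA, EB.
  apply injective_projections; simpl; field.
Qed.

Lemma Rpower_m3_2 (y : R) : (0 < y)%R -> Rpower y (- 3 / 2) = (/ (y * sqrt y))%R.
Proof.
  intros Hy. replace (- 3 / 2)%R with (- (1 + / 2))%R by field.
  now rewrite Rpower_Ropp, Rpower_plus, Rpower_1, Rpower_sqrt.
Qed.

Theorem theorem1p3 (M mu : R) (hM : (0 <= M)%R) (hmu : (0 < mu)%R) :
  exists E1 E2 : R -> R -> C,
    (forall (r y t : R) (nu : C),
        (Rabs r <= M)%R -> (0 < y)%R ->
        t = (y * cosh mu)%R -> nu = RtoC r + Ci * RtoC t ->
        besselK nu y =
          RtoC (sqrt (2 * PI / (y * sinh mu)))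
          * Cexp (RtoC (- y * (PI / 2) * cosh mu) + Ci * RtoC (r * (PI / 2)))
          * (RtoC (cosh (r * mu)
                   * sin (PI / 4 - y * (sinh mu - mu * cosh mu)))
             - Ci * RtoC (sinh (r * mu)
                   * cos (PI / 4 - y * (sinh mu - mu * cosh mu))))
          + E1 r y + E2 r y) /\
    unif_bigO (fun r => (Rabs r <= M)%R) E1
      (fun y => RtoC (Rpower y (- 3 / 2))
         * Cexp (- RtoC y * (RtoC (PI / 2 * cosh mu)
                             + Ci * RtoC (sinh mu - mu * cosh mu)))) /\
    unif_bigO (fun r => (Rabs r <= M)%R) E2
      (fun y => RtoC (Rpower y (- 3 / 2))
         * Cexp (- RtoC y * (RtoC (PI / 2 * cosh mu)
                             - Ci * RtoC (sinh mu - mu * cosh mu)))).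
Proof.
  destruct (half_line_asymptotics M mu hM hmu) as (K & Y & HY & HK & HL).
  exists (fun r y => besselK (RtoC r + Ci * RtoC (y * cosh mu)) y
    - RtoC (1 / 2) *
      ((1, -1)%R * kernel r y (y * cosh mu) (saddle mu)
         * RtoC (sqrt (PI / (y * sinh mu)))
       + Cconj ((1, -1)%R * kernel (- r) y (y * cosh mu) (saddle mu)
         * RtoC (sqrt (PI / (y * sinh mu)))))), (fun _ _ => RtoC 0).
  split; [|split].
  - intros r y t nu _ Hy -> ->. rewrite (saddle_terms r y mu hmu Hy). ring.
  - exists K, Y. intros y Hy r Hr.
    destruct (HL r y Hr ltac:(lra)) as (L & HLt & HLb).
    destruct (HL (- r)%R y ltac:(now rewrite Rabs_Ropp) ltac:(lra)) as (L' & HLt' & HLb').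
    cbv beta zeta in *. rewrite (besselK_limits r y _ L L' HLt HLt').
    set (t := (y * cosh mu)%R) in *. set (q := RtoC (sqrt _)) in *.
    set (T := (1, -1)%R * kernel r y t (saddle mu) * q) in *.
    set (T' := (1, -1)%R * kernel (- r) y t (saddle mu) * q) in *.
    (* the point where the contour is cut is its own reflection *)
    pose proof (kernel_primitive_reflect r y t (0, (PI / 2 + half_width mu))%R) as R0.
    replace (- Cconj (0, (PI / 2 + half_width mu))%R)
      with ((0, (PI / 2 + half_width mu))%R : C) in R0
      by (apply injective_projections; simpl; ring).
    set (D := kernel_primitive r y t _) in *.
    set (D' := kernel_primitive (- r) y t _) in *.
    replace (RtoC (1 / 2) * (L + Cconj L') - RtoC (1 / 2) * (T + Cconj T')) with
      (RtoC (1 / 2) * ((L - D - T) + Cconj (L' - D' - T'))).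
    2:{ rewrite !Cminus_conj, R0. ring. }
    rewrite !Cmod_mult, !Cmod_R, Cmod_Cexp, Rpower_m3_2 by lra.
    assert (0 < y * sqrt y)%R by (apply Rmult_lt_0_compat; [|apply sqrt_lt_R0]; lra).
    rewrite (Rabs_pos_eq (1 / 2)), Rabs_pos_eq
      by (first [lra | left; now apply Rinv_0_lt_compat]).
    match goal with |- (_ <= _ * (_ * exp ?x))%R =>
      replace x with (- y * (PI / 2) * cosh mu)%R by (simpl; ring) end.
    pose proof (Cmod_triangle (L - D - T) (Cconj (L' - D' - T'))) as Tr.
    rewrite Cmod_conj in Tr. unfold Rdiv in *. lra.
  - exists 0%R, 0%R. intros y _ r _. rewrite Cmod_R, Rabs_R0. lra.
Qed.
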